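(* For an integer $m\ge2$ and $\tau>0$, $\varepsilon>0$, consider the equation $$\partial_t^mu(t)=\mathcal{A}u(t-\tau)-\varepsilon(-\mathcal{A})^\alpha u(t),\quad t>0.\qquad( * )$$ (i) For every $m\ge2$ and every $\alpha<1$ there are operators $\mathcal{A}$, of the type described in the context, in a Hilbert space $\mathcal{H}$, for which the problem associated to $( * )$ is ill-posed. (ii) For $m=2$ and $\alpha\in(-\infty,1)$, the problem associated to $( * )$ is ill-posed for every operator $\mathcal{A}$ of the type described in the context, i.e., for an arbitrarily prescribed sequence of eigenvalues $\tilde\lambda_j\to-\infty$.
   Context: Operators considered: $\mathcal{H}$ is a complex Hilbert space, $\mathcal{A}$ is a self-adjoint operator in $\mathcal{H}$ with $-\mathcal{A}$ positive, having a complete orthonormal set of eigenfunctions $(\Phi_j)_{j\in\mathbb{N}}$ with eigenvalues $\tilde\lambda_j<0$, $\tilde\lambda_j\to-\infty$ as $j\to\infty$; $(-\mathcal{A})^\alpha u=\sum_j(-\tilde\lambda_j)^\alpha\langle u,\Phi_j\rangle\Phi_j$. The problem associated to $( * )$ consists of $( * )$ with prescribed initial values $\partial_t^ku(0)$, $k=0,\dots,m-1$, and prescribed history $u(t)=\varphi(t)$ for $t\in(-\tau,0)$. It is called ill-posed if there exist solutions $(u_j)_{j\in\mathbb{N}}$ such that, for any fixed $t>0$, $\|u_j(t)\|_{\mathcal{H}}\to\infty$ as $j\to\infty$, while the norm of the data $(u_j(0),\dots,\partial_t^{m-1}u_j(0),\varphi_j)$, $\varphi_j:=u_j|_{(-\tau,0)}$,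 in $\mathcal{H}^m\times L^2((-\tau,0),\mathcal{H})$ remains bounded. *)

(* Defs.v *)
From HB Require Import structures.
From mathcomp Require Import all_boot all_order all_algebra.
From mathcomp Require Import all_classical all_reals all_analysis.
From mathcomp Require Export complex.

Set Implicit Arguments.
Unset Strict Implicit.
Unset Printing Implicit Defensive.
Import Order.TTheory GRing.Theory Num.Theory.
Import numFieldNormedType.Exports.
Local Open Scope classical_set_scope.
Local Open Scope ring_scope.
Local Open Scope complex_scope.

Record hilbertSpace (R : realType) := HilbertSpace {
  hilbert_sort :> completeNormedModType R[i];
  (* linear in the first argument, conjugate-linear in the second *)
  inner : {dot hilbert_sort for @Num.conj R[i]};
  inner_norm : forall u : hilbert_sort, inner u u = `|u| ^+ 2 }.

(* The norm of a normed module over R[i] takes its values in R[i]. *)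
Definition hnorm (R : realType) (V : normedModType R[i]) (u : V) : R :=
  complex.Re `|u|.

(* The values of [op] outside [dom] are irrelevant. *)
Record operator (R : realType) (H : hilbertSpace R) := Operator {
  dom : set H;
  op :> H -> H;
  dom0 : dom 0;
  domP : forall (a : R[i]) (u v : H), dom u -> dom v -> dom (a *: u + v);
  opP : forall (a : R[i]) (u v : H), dom u -> dom v ->
    op (a *: u + v) = a *: op u + op v }.

Definition adjoint_graph (R : realType) (H : hilbertSpace R) (A : operator H)
    (v w : H) : Prop :=
  forall u : H, dom A u -> inner H (A u) v = inner H u w.

Definition self_adjoint (R : realType) (H : hilbertSpace R) (A : operator H) :
    Prop :=
  dense (dom A) /\
  forall v w : H, adjoint_graph A v w <-> dom A v /\ A v = w.

Definition neg_positive (R : realType) (H : hilbertSpace R) (A : operator H) :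
    Prop :=
  forall u : H, dom A u -> 0 <= inner H (- A u) u.

Definition complete_orthonormal (R : realType) (H : hilbertSpace R)
    (Phi : nat -> H) : Prop :=
  (forall i j : nat, inner H (Phi i) (Phi j) = (i == j)%:R) /\
  (forall u : H, (forall j : nat, inner H u (Phi j) = 0) -> u = 0).

Record eigenOperator (R : realType) (H : hilbertSpace R) := EigenOperator {
  eop :> operator H;
  eigfun : nat -> H;
  eigval : nat -> R;
  eop_self_adjoint : self_adjoint eop;
  eop_neg_positive : neg_positive eop;
  eigfun_complete : complete_orthonormal eigfun;
  eigfun_dom : forall j : nat, dom eop (eigfun j);
  eigfunP : forall j : nat, eop (eigfun j) = (eigval j)%:C *: eigfun j;
  eigval_lt0 : forall j : nat, eigval j < 0;
  eigval_cvg : eigval j @[j --> \oo] --> -oo }.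

Definition fpow_series (R : realType) (H : hilbertSpace R)
    (A : eigenOperator H) (alpha : R) (u : H) : nat -> H :=
  series (fun j : nat =>
    (((- eigval A j) `^ alpha)%:C * inner H u (eigfun A j)) *: eigfun A j).

Definition fpow_dom (R : realType) (H : hilbertSpace R)
    (A : eigenOperator H) (alpha : R) : set H :=
  [set u : H | cvgn (fpow_series A alpha u)].

Definition fpow (R : realType) (H : hilbertSpace R)
    (A : eigenOperator H) (alpha : R) (u : H) : H :=
  limn (fpow_series A alpha u).

(* Derivatives with respect to the real variable t of functions with values in
   a complex normed module, relative to [0, +oo[ : one-sided at t = 0, where no
   relation between u(0) and the history is imposed. Only meaningful for
   0 <= t. *)
Definition dquot (R : realType) (V : normedModType R[i]) (v : R -> V) (t h : R)
    : V :=
  (h%:C)^-1 *: (v (t + h) - v t).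

Definition derivable_t (R : realType) (V : normedModType R[i]) (v : R -> V)
    (t : R) : Prop :=
  cvg (dquot v t h @[h --> within [set h : R | 0 <= t + h] (0 : R)^']).

Definition deriv_t (R : realType) (V : normedModType R[i]) (v : R -> V)
    (t : R) : V :=
  lim (dquot v t h @[h --> within [set h : R | 0 <= t + h] (0 : R)^']).

Definition derivn_t (R : realType) (V : normedModType R[i]) (k : nat)
    (v : R -> V) : R -> V :=
  iter k (@deriv_t R V) v.

(* The space L^2(I, V) of Bochner square-integrable functions. *)
Definition simple_on (R : realType) (V : normedModType R[i]) (I : set R)
    (s : R -> V) : Prop :=
  finite_set (s @` I) /\ forall x : V, measurable (I `&` s @^-1` [set x]).

Definition strongly_measurable (R : realType) (V : normedModType R[i])
    (I : set R) (f : R -> V) : Prop :=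
  exists s : nat -> R -> V,
    (forall n : nat, simple_on I (s n)) /\
    {ae @lebesgue_measure R, forall t : R, I t -> s n t @[n --> \oo] --> f t}.

Definition L2_sqnorm (R : realType) (V : normedModType R[i]) (I : set R)
    (f : R -> V) : \bar R :=
  (\int[@lebesgue_measure R]_(t in I) (hnorm (f t) ^+ 2)%:E)%E.

Definition in_L2 (R : realType) (V : normedModType R[i]) (I : set R)
    (f : R -> V) : Prop :=
  strongly_measurable I f /\ (L2_sqnorm I f < +oo)%E.

(* Classical solutions: u is C^(m-1) on [0, +oo[ and C^m on ]0, +oo[, the
   history u|(-tau, 0) is in L^2, and the equation holds at every t > 0. *)
Record is_solution (R : realType) (H : hilbertSpace R) (A : eigenOperator H)
    (m : nat) (tau eps alpha : R) (u : R -> H) : Prop := IsSolution {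
  sol_history : in_L2 `]- tau, 0[ u;
  sol_derivable0 : forall (k : nat) (t : R), (k < m.-1)%N -> 0 <= t ->
    derivable_t (derivn_t k u) t;
  sol_continuous0 : {within `[0, +oo[, continuous (derivn_t m.-1 u)};
  sol_derivable : forall t : R, 0 < t -> derivable_t (derivn_t m.-1 u) t;
  sol_continuous : {within `]0, +oo[, continuous (derivn_t m u)};
  sol_dom : forall t : R, 0 < t -> dom A (u (t - tau));
  sol_fpow_dom : forall t : R, 0 < t -> fpow_dom A alpha (u t);
  sol_eq : forall t : R, 0 < t ->
    derivn_t m u t = A (u (t - tau)) - eps%:C *: fpow A alpha (u t) }.

(* Norm of (u(0), ..., u^(m-1)(0), u|(-tau, 0)) in H^m x L^2((-tau, 0), H). *)
Definition data_norm (R : realType) (H : hilbertSpace R) (m : nat) (tau : R)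
    (u : R -> H) : R :=
  Num.sqrt (\sum_(k < m) hnorm (derivn_t k u 0) ^+ 2
            + fine (L2_sqnorm `]- tau, 0[ u)).

Definition ill_posed (R : realType) (H : hilbertSpace R) (A : eigenOperator H)
    (m : nat) (tau eps alpha : R) : Prop :=
  exists u : nat -> R -> H,
    [/\ forall j : nat, is_solution A m tau eps alpha (u j),
        forall t : R, 0 < t -> hnorm (u j t) @[j --> \oo] --> +oo
      & exists M : R, forall j : nat, data_norm m tau (u j) <= M].

(* Main.v *)
Require Import Defs.
From HB Require Import structures.
From mathcomp Require Import all_boot all_order all_algebra.
From mathcomp Require Import all_classical all_reals all_analysis.
From mathcomp Require Import measurable_realfun ring lra.
Import Order.TTheory GRing.Theory Num.Theory.
Import numFieldNormedType.Exports HBNNSimple.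
Set Implicit Arguments.
Unset Strict Implicit.
Unset Printing Implicit Defensive.
Local Open Scope classical_set_scope.
Local Open Scope complex_scope.
Local Open Scope ring_scope.

(** Along an eigenfunction of eigenvalue [- lam] the equation has the solutions
    [exp (w t)] with [(w ^ m + c) exp (tau w) = - lam], [c = eps lam ^ alpha].
    Let [a] be the real solution of [(a ^ m + c) exp (tau a) = lam]; since
    [alpha < 1], [a] tends to infinity with [lam]. The number
    [w0 = a + i pi / tau] is almost a root, because [(w0 ^ m + c) / (a ^ m + c)]
    is [1 + O(1 / a)], and Banach's fixed point theorem yields a root [w] at
    bounded distance from [w0], uniformly in [c >= 0]. The solution with initial
    value of norm [(a + K) ^ - m] has bounded data, while at every fixed [t > 0]
    its norm, about [exp (a t) a ^ - m], tends to infinity. This works for every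
    [m >= 1] and every sequence of eigenvalues, so for (i) it remains to exhibit
    one operator: the multiplication by [- (n + 1)] in [l^2]. *)

Local Notation Re := (@complex.Re _).
Local Notation Im := (@complex.Im _).

(** * Complex modulus and exponential *)

(** The norm on [R[i]] takes its values in [R[i]]; a real-valued modulus makes the estimates
    accessible to [lra] and [nra], and the lock keeps simplification from unfolding it. *)
HB.lock Definition cmod (R : rcfType) (z : R[i]) : R := Normc.normc z.
Arguments cmod {R} z.

Section modulus.
Context {R : rcfType}.
Implicit Types (x y z : R[i]) (a : R).

Lemma cmodE z : cmod z = Num.sqrt (Re z ^+ 2 + Im z ^+ 2).
Proof. by rewrite cmod.unlock; case: z. Qed.

Lemma cmod_ge0 z : 0 <= cmod z.
Proof. by rewrite cmodE sqrtr_ge0. Qed.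

Lemma cmodM x y : cmod (x * y) = cmod x * cmod y.
Proof. rewrite cmod.unlock; exact: Normc.normcM. Qed.

Lemma cmodD x y : cmod (x + y) <= cmod x + cmod y.
Proof. rewrite cmod.unlock; exact: le_normcD. Qed.

Lemma cmodN x : cmod (- x) = cmod x.
Proof. rewrite cmod.unlock; exact: normcN. Qed.

Lemma cmodB x y : cmod (x - y) <= cmod x + cmod y.
Proof. by rewrite -(cmodN y) cmodD. Qed.

Lemma cmodR a : cmod a%:C = `|a|.
Proof. by rewrite cmodE/= expr0n/= addr0 sqrtr_sqr. Qed.

Lemma cmod1 : cmod (1 : R[i]) = 1.
Proof. rewrite cmod.unlock; exact: Normc.normc1. Qed.

Lemma cmod_eq0 x : cmod x = 0 -> x = 0.
Proof. by rewrite cmod.unlock; exact: Normc.eq0_normc. Qed.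

Lemma cmodX x n : cmod (x ^+ n) = cmod x ^+ n.
Proof. by elim: n => [|n IH]; rewrite ?expr0 ?cmod1// !exprS cmodM IH. Qed.

Lemma sqr_cmod z : cmod z ^+ 2 = Re z ^+ 2 + Im z ^+ 2.
Proof. by rewrite cmodE sqr_sqrtr// addr_ge0 ?sqr_ge0. Qed.

Lemma normCE z : `|z| = (cmod z)%:C.
Proof. by rewrite cmod.unlock. Qed.

Lemma cmod0 : cmod (0 : R[i]) = 0.
Proof. by rewrite cmod.unlock Normc.normc0. Qed.

Lemma abs_Re_le_cmod z : `|Re z| <= cmod z.
Proof.
by rewrite -(@ler_pXn2r _ 2)// ?nnegrE ?cmod_ge0// sqr_cmod real_normK
  ?num_real// lerDl sqr_ge0.
Qed.

Lemma abs_Im_le_cmod z : `|Im z| <= cmod z.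
Proof.
by rewrite -(@ler_pXn2r _ 2)// ?nnegrE ?cmod_ge0// sqr_cmod real_normK
  ?num_real// lerDr sqr_ge0.
Qed.

Lemma cmod_le_ReIm z : cmod z <= `|Re z| + `|Im z|.
Proof.
rewrite -(@ler_pXn2r _ 2)// ?nnegrE ?cmod_ge0 ?addr_ge0// sqr_cmod sqrrD.
rewrite !real_normK ?num_real// [_ + _ *+ 2]addrC -addrA lerDr.
by rewrite mulrn_wge0// mulr_ge0.
Qed.

(** The mean value inequality for the power on the disc of radius [B], where the derivative has
    modulus at most [n.+1%:R * B ^+ n]. *)
Lemma cmodXB x y B n : cmod x <= B -> cmod y <= B ->
  cmod (x ^+ n.+1 - y ^+ n.+1) <= n.+1%:R * B ^+ n * cmod (x - y).
Proof.
move=> xB yB; have B0 : 0 <= B by apply: le_trans xB; exact: cmod_ge0.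
elim: n => [|n IH]; first by rewrite !expr1 expr0 !mul1r.
have -> : x ^+ n.+2 - y ^+ n.+2 =
    x * (x ^+ n.+1 - y ^+ n.+1) + (x - y) * y ^+ n.+1.
  by rewrite ![_ ^+ n.+2]exprS; ring.
apply: (le_trans (cmodD _ _)); rewrite !cmodM cmodX.
have h1 : cmod x * cmod (x ^+ n.+1 - y ^+ n.+1) <=
    B * (n.+1%:R * B ^+ n * cmod (x - y)).
  by apply: ler_pM => //; exact: cmod_ge0.
have h2 : cmod (x - y) * cmod y ^+ n.+1 <= cmod (x - y) * B ^+ n.+1.
  by rewrite ler_wpM2l ?cmod_ge0// lerXn2r// nnegrE ?cmod_ge0.
apply: (le_trans (lerD h1 h2)); rewrite -[n.+2]addn1 natrD !exprS.
by rewrite le_eqVlt; apply/orP; left; apply/eqP; ring.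
Qed.

End modulus.

HB.lock Definition cexp (R : realType) (z : R[i]) : R[i] :=
  (expR (Re z))%:C * (cos (Im z) +i* sin (Im z)).

Arguments cexp {R} z.

Section complex_exponential.
Context {R : realType}.
Implicit Types (x y : R) (z w : R[i]).

Lemma cexpE x y : cexp (x +i* y) = (expR x * cos y) +i* (expR x * sin y).
Proof. by rewrite cexp.unlock /=; apply/eqP;
  rewrite eq_complex /= !mul0r subr0 addr0 !eqxx. Qed.

Lemma cexp0 : cexp (0 : R[i]) = 1.
Proof. by rewrite cexpE expR0 cos0 sin0 !mul1r. Qed.

Lemma cexpD z w : cexp (z + w) = cexp z * cexp w.
Proof.
case: z w => a b [c d]; rewrite [_ + _]/= !cexpE expRD cosD sinD.
by apply/eqP; rewrite eq_complex /=; apply/andP; split; apply/eqP; ring.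
Qed.

Lemma cmod_cexp z : cmod (cexp z) = expR (Re z).
Proof.
rewrite cexp.unlock cmodM cmodR ger0_norm ?expR_ge0// cmodE/= cos2Dsin2.
by rewrite sqrtr1 mulr1.
Qed.

Lemma cexpNK z : cexp (- z) * cexp z = 1.
Proof. by rewrite -cexpD addNr cexp0. Qed.

Lemma cexp_pi x : cexp (x +i* pi) = - (expR x)%:C.
Proof. by rewrite cexpE cospi sinpi mulr0 mulrN1; apply/eqP;
  rewrite eq_complex /= oppr0 !eqxx. Qed.

Lemma abs_sin_le x : `|sin x| <= `|x|.
Proof.
wlog x0 : x / 0 <= x.
  move=> W; have [/W//|x0] := leP 0 x.
  by rewrite -normrN -sinN -[leRHS]normrN; apply: W; rewrite oppr_ge0 ltW.
have dsin y : y \in `]0, x[ -> is_derive y 1 sin (cos y) by move=> _;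
  exact: is_derive_sin.
have csin : {within `[0, x], continuous (@sin R)}.
  by apply: continuous_subspaceT => ?; exact: continuous_sin.
have [c _] := MVT_segment x0 dsin csin; rewrite sin0 !subr0 => ->;
  rewrite normrM ler_piMl//.
exact: cos_max.
Qed.

(** Half-angle formula: [cos x] is [1 - 2 * sin (x / 2) ^+ 2], and [abs_sin_le] bounds the sine. *)
Lemma cos_lower x : 1 - x ^+ 2 / 2 <= cos x.
Proof.
have -> : x = (x / 2) + (x / 2) by lra.
have := abs_sin_le (x / 2); rewrite -(@ler_pXn2r _ 2)// ?nnegrE//.
rewrite !real_normK ?num_real// cosD.
have := cos2Dsin2 (x / 2).
set s := sin _; set c := cos _; nra.
Qed.

(** The mean value theorem for [sin - id], whose derivative [cos c - 1] lies between [- c ^+ 2 / 2]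
    and [0]; the assumption lowers the resulting cubic bound to a quadratic one. *)
Lemma abs_sinB_le x : `|x| <= 1 -> `|sin x - x| <= x ^+ 2 / 2.
Proof.
wlog x0 : x / 0 <= x.
  move=> W; have [/W//|x0] := leP 0 x.
  move=> x1; have := W (- x); rewrite oppr_ge0 sinN normrN sqrrN =>
    /(_ (ltW x0) x1).
  by rewrite -opprD normrN.
move=> x1.
have ds y : y \in `]0, x[ -> is_derive y 1 (@sin R - id) (cos y - 1).
  by move=> _; exact: is_deriveB.
have cs : {within `[0, x], continuous (@sin R - id)}.
  apply: continuous_subspaceT => y; apply: continuousB; last exact: cvg_id.
  exact: continuous_sin.
have [c] := MVT_segment x0 ds cs; rewrite in_itv/= !fctE sin0 !subr0 =>
  /andP[c0 cx] ->.
have := cos_lower c; have := cos_le1 c.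
rewrite normrM (ger0_norm x0); rewrite ger0_norm// in x1.
move=> c1 c2; rewrite distrC ger0_norm ?subr_ge0//.
have : c ^+ 2 <= x ^+ 2 by rewrite lerXn2r// nnegrE.
move: (cos c) c1 c2 => C; nra.
Qed.

(** Both sides come from [1 + x <= expR x], used at [x] and at [- x]: the latter gives
    [(1 - x) * expR x <= 1], and [1 / (1 - x)] is at most [1 + x + 2 * x ^+ 2] for [x <= 1 / 2]. *)
Lemma abs_expRB_le x : `|x| <= 1 / 2 -> `|expR x - 1 - x| <= 2 * x ^+ 2.
Proof.
move=> xh; have := expR_ge1Dx x; have := expR_ge1Dx (- x); rewrite expRN.
have := expR_gt0 x; move: (expR x) => e e0 h1 h2.
have : (1 - x) * e <= 1 by rewrite -[leRHS](mulVf (lt0r_neq0 e0)) ler_pM2r.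
move: xh; rewrite !ler_norml => /andP[? ?] h3; apply/andP; split; nra.
Qed.

(** The real and imaginary parts are each split into two products of real remainders. The four
    pieces are at most [y ^+ 2], [2 * x ^+ 2], [y ^+ 2] and [x ^+ 2 + y ^+ 2], in total three times
    the squared modulus. *)
Lemma cmod_cexpB_le z : cmod z <= 1 / 2 ->
  cmod (cexp z - 1 - z) <= 4 * cmod z ^+ 2.
Proof.
move=> zh; have := le_trans (abs_Re_le_cmod z) zh;
  have := le_trans (abs_Im_le_cmod z) zh.
rewrite sqr_cmod; case: z {zh} => x y; rewrite ![Re _]/= ![Im _]/= => yh xh.
have y1 : `|y| <= 1 by lra.
have := abs_expRB_le xh; have := abs_sinB_le y1; have := cos_lower y;
  have := cos_le1 y.
rewrite cexpE => c1 c2 s1 e1.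
apply: (le_trans (cmod_le_ReIm _)) => /=.
rewrite !subr0.
have e2 : expR x <= 2.
  by move: e1 xh; rewrite !ler_norml => /andP[? ?] /andP[? ?]; nra.
have e3 : `|expR x - 1| <= 2 * `|x|.
  have -> : expR x - 1 = (expR x - 1 - x) + x by ring.
  apply: (le_trans (ler_normD _ _)).
  have : x ^+ 2 = `|x| ^+ 2 by rewrite real_normK ?num_real.
  have := normr_ge0 x; nra.
have e0 := expR_gt0 x.
have e2M (u v : R) : 0 <= u -> u <= v / 2 -> expR x * u <= v by move=> ? ?; nra.
have -> : expR x * cos y - 1 - x = expR x * (cos y - 1) + (expR x - 1 - x).
  by ring.
have -> : expR x * sin y - y = expR x * (sin y - y) + y * (expR x - 1) by ring.
have h1 : `|expR x * (cos y - 1)| <= y ^+ 2.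
  have c3 : 1 - cos y <= y ^+ 2 / 2. by lra.
  rewrite normrM gtr0_norm// distrC ger0_norm ?subr_ge0//.
  by apply: e2M => //; rewrite subr_ge0.
have h2 : `|expR x * (sin y - y)| <= y ^+ 2.
  by rewrite normrM gtr0_norm// e2M.
have h3 : `|y * (expR x - 1)| <= x ^+ 2 + y ^+ 2.
  rewrite normrM.
  have : `|x| ^+ 2 = x ^+ 2 by rewrite real_normK ?num_real.
  have : `|y| ^+ 2 = y ^+ 2 by rewrite real_normK ?num_real.
  move=> yy xx; have := ler_wpM2l (normr_ge0 y) e3.
  by have := sqr_ge0 (`|x| - `|y|); rewrite -xx -yy; nra.
have := ler_normD (expR x * (cos y - 1)) (expR x - 1 - x).
have := ler_normD (expR x * (sin y - y)) (y * (expR x - 1)).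
nra.
Qed.

End complex_exponential.

(** Joins the complete and the normed module structures on matrices, as Banach's theorem in
    ['rV[R]_2] requires. *)
HB.instance Definition _ (R : realType) m n := Complete.on 'M[R]_(m.+1, n.+1).

(** * Roots of the characteristic equation *)

Section roots.
Context {R : realType}.
Implicit Types (x y : R) (z w : R[i]).

(** Factoring out [cexp w] reduces the estimate to the quadratic remainder at [z - w]. Since
    [cmod (z - w) <= 1 / 40], that remainder contributes [8 / 40], and [cmod (cexp w - 1) <= 1 / 40]
    contributes the rest. *)
Lemma cexp_lipschitz z w : cmod z <= 1 / 80 -> cmod w <= 1 / 80 ->
  cmod (cexp z - cexp w - (z - w)) <= 9 / 40 * cmod (z - w).
Proof.
move=> hz hw.
have hzw : cmod (z - w) <= 1 / 40 by have := cmodB z w; lra.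
have ew : expR (Re w) <= 2.
  have h : `|Re w| <= 1 / 2 by have := abs_Re_le_cmod w; lra.
  have := abs_expRB_le h; move: h; rewrite !ler_norml => /andP[? ?] /andP[? ?].
  nra.
have e1 : cmod (cexp w - 1) <= 2 * cmod w.
  have -> : cexp w - 1 = (cexp w - 1 - w) + w by ring.
  apply: (le_trans (cmodD _ _)).
  have hw2 : cmod w <= 1 / 2 by lra.
  by have := cmod_cexpB_le hw2; have := cmod_ge0 w; nra.
have -> : cexp z - cexp w - (z - w) =
    cexp w * (cexp (z - w) - 1 - (z - w)) + (cexp w - 1) * (z - w).
  have -> : cexp z = cexp w * cexp (z - w) by rewrite -cexpD; congr cexp; ring.
  ring.
apply: (le_trans (cmodD _ _)); rewrite !cmodM cmod_cexp.
have hzw2 : cmod (z - w) <= 1 / 2 by lra.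
have h1 := cmod_cexpB_le hzw2.
have h2 : expR (Re w) * cmod (cexp (z - w) - 1 - (z - w)) <=
    8 * cmod (z - w) ^+ 2.
  apply: (@le_trans _ _ (2 * (4 * cmod (z - w) ^+ 2))); last by lra.
  by apply: ler_pM; rewrite ?expR_ge0 ?cmod_ge0.
have h3 : cmod (cexp w - 1) * cmod (z - w) <= 1 / 40 * cmod (z - w).
  by rewrite ler_wpM2r ?cmod_ge0//; lra.
have := cmod_ge0 (z - w); nra.
Qed.

(* [R[i]] is not equipped with a complete normed module structure over [R], so
   Banach's fixed point theorem is applied in ['rV[R]_2] with the sup norm. *)
Let vec z : 'rV[R]_2 := \row_(i < 2) if i == ord0 then Re z else Im z.
Let unvec (v : 'rV[R]_2) : R[i] := v ord0 ord0 +i* v ord0 ord_max.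

Let vecK z : unvec (vec z) = z.
Proof. by rewrite /unvec !mxE /=; case: z. Qed.

Let norm_vecP (v : 'rV[R]_2) e : 0 <= e ->
  (`|v| <= e) = (`|Re (unvec v)| <= e) && (`|Im (unvec v)| <= e).
Proof.
move=> e0; rewrite [`|v|]mx_normrE.
apply/idP/idP.
  move=> h; apply/andP; split; apply: le_trans h;
    exact: (le_bigmax _ _ (ord0, _)).
move=> /andP[h0 h1]; apply: bigmax_le => // -[i j] _ /=.
rewrite (ord1 i); case: j => -[|[|//]] hj.
  by rewrite (_ : Ordinal hj = ord0)//; exact: val_inj.
by rewrite (_ : Ordinal hj = ord_max)//; exact: val_inj.
Qed.

Let cmod_unvec v : cmod (unvec v) <= 2 * `|v|.
Proof.
apply: (le_trans (cmod_le_ReIm _)).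
have : `|v| <= `|v| by [].
by rewrite norm_vecP// => /andP[]; lra.
Qed.

Let norm_vec z : `|vec z| <= cmod z.
Proof. by rewrite norm_vecP ?cmod_ge0// vecK abs_Re_le_cmod abs_Im_le_cmod. Qed.

(* The root is a fixed point of [z - (exp z * q z - 1)], a contraction because
   [exp z * q z] is [C^1]-close to [1 + z]. *)
Lemma cexpM_near1_root (q : R[i] -> R[i]) :
  (forall z, cmod z <= 1 / 80 -> cmod (q z - 1) <= 1 / 320) ->
  (forall z w, cmod z <= 1 / 80 -> cmod w <= 1 / 80 ->
     cmod (q z - q w) <= 1 / 320 * cmod (z - w)) ->
  exists2 z, cmod z <= 1 / 80 & cexp z * q z = 1.
Proof.
move=> q1 qL.
pose G z := z - (cexp z * q z - 1).
(* The three contributions are [9 / 40], [2 / 320] and [2 / 320], together below [1 / 4]. *)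
have GL z w : cmod z <= 1 / 80 -> cmod w <= 1 / 80 ->
    cmod (G z - G w) <= 1 / 4 * cmod (z - w).
  move=> hz hw; have h1 := cexp_lipschitz hz hw.
  have -> : G z - G w = - (cexp z - cexp w - (z - w)) -
     (cexp z * (q z - q w) + (cexp z - cexp w) * (q w - 1)) by rewrite /G; ring.
  apply: (le_trans (cmodB _ _)); rewrite cmodN.
  have := cmodD (cexp z * (q z - q w)) ((cexp z - cexp w) * (q w - 1)).
  rewrite !cmodM cmod_cexp.
  have ez : expR (Re z) <= 2.
    have h : `|Re z| <= 1 / 2 by have := abs_Re_le_cmod z; lra.
    have := abs_expRB_le h; move: h; rewrite !ler_norml =>
      /andP[? ?] /andP[? ?].
    nra.
  have e2 : cmod (cexp z - cexp w) <= 2 * cmod (z - w).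
    have -> : cexp z - cexp w = (cexp z - cexp w - (z - w)) + (z - w) by ring.
    by apply: (le_trans (cmodD _ _)); have := cmod_ge0 (z - w); lra.
  have h2 : expR (Re z) * cmod (q z - q w) <= 2 * (1 / 320 * cmod (z - w)).
    by apply: ler_pM; rewrite ?expR_ge0 ?cmod_ge0// qL.
  have h3 : cmod (cexp z - cexp w) * cmod (q w - 1) <=
      2 * cmod (z - w) * (1 / 320).
    by apply: ler_pM; rewrite ?expR_ge0 ?cmod_ge0// q1.
  have := cmod_ge0 (z - w); lra.
(* The modulus is at most twice the sup norm: radius [1 / 160] stays inside the disc of radius
   [1 / 80], and the constant [1 / 4] of [G] becomes [1 / 2] for [F]. Then [F] preserves [U] because
   half the radius plus [1 / 320] is the radius. *)
pose U : set 'rV[R]_2 := [set v | `|v| <= 1 / 160].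
pose F v := vec (G (unvec v)).
have Uc v : U v -> cmod (unvec v) <= 1 / 80.
   by rewrite /U/= => h; have := cmod_unvec v; lra.
have FL (v w : 'rV[R]_2) : U v -> U w -> `|F v - F w| <= 1 / 2 * `|v - w|.
  move=> Uv Uw.
  have -> : F v - F w = vec (G (unvec v) - G (unvec w)).
    apply/rowP => i; rewrite !mxE.
    by case: (G (unvec v)) (G (unvec w)) => a b [c d]; case: ifP.
  apply: (le_trans (norm_vec _)).
  apply: (le_trans (GL _ _ (Uc _ Uv) (Uc _ Uw))).
  have -> : unvec v - unvec w = unvec (v - w) by rewrite /unvec !mxE.
  by have := cmod_unvec (v - w); set a := `|v - w|; lra.
have U0 : U 0 by rewrite /U/= normr0.
have F0 : `|F 0| <= 1 / 320.
  apply: (le_trans (norm_vec _)).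
  have -> : unvec 0 = 0 by rewrite /unvec !mxE.
  by rewrite /G cexp0 mul1r sub0r cmodN q1// cmod0.
have FU : {homo F : v / U v >-> U v}.
  move=> v Uv; rewrite /U/=; have := FL _ _ Uv U0; rewrite subr0.
  have := ler_normD (F v - F 0) (F 0); rewrite subrK.
  by move: Uv F0; rewrite /U/=; set a := `|v|; set b := `|F 0|;
    set c := `|F v|; set d := `|F v - F 0|; lra.
have ctr : is_contraction (mkfun FU : {fun U >-> U}).
  have h0 : 0 <= 1 / 2 :> R by lra.
  exists (NngNum h0); split => /=; first by lra.
  by move=> [v w] [/= Uv Uw]; exact: FL.
have clU : closed U.
  have -> : U = closed_ball_ (@Num.norm R _) (0 : 'rV[R]_2) (1 / 160).
    by rewrite /closed_ball_; apply/seteqP; split => v /=; rewrite sub0r normrN.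
  exact: closed_closed_ball_.
have [v Uv vE] := banach_fixed_point ctr clU (ex_intro _ _ U0).
exists (unvec v); first exact: Uc.
have : unvec v = G (unvec v) by rewrite {1}vE /= /mkfun vecK.
rewrite -[LHS]subr0 => /addrI /oppr_inj /esym/eqP.
by rewrite subr_eq0 => /eqP.
Qed.

(** With [w = W z], that is [a + (i pi + z) / tau], the factor [cexp (tau%:C * w)] is
    [- expR (tau * a)] times [cexp z], so the equation becomes [cexp z * q z = 1] with [q z] the
    quotient of [P w] by [P a]. For large [a] this [q] is close to 1 with a small Lipschitz
    constant. The bounds are uniform in [c], which cancels in differences of [P] and can only
    enlarge the denominator [A]. *)
Lemma char_root_near m (tau : R) : 0 < tau -> exists2 K, 1 <= K &
  forall a c, K <= a -> 0 <= c -> exists w : R[i],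
    [/\ a - K <= Re w, cmod w <= a + K &
        (w ^+ m.+1 + c%:C) * cexp (tau%:C * w) =
        - ((a ^+ m.+1 + c) * expR (tau * a))%:C].
Proof.
move=> tau0.
(* Bounds the distance from [W z] to [a], since [cmod z <= 1]. *)
pose K0 : R := (pi + 1) / tau.
have pi0 := pi_gt0 R.
have K00 : 0 < K0 by rewrite divr_gt0//; lra.
(* On the disc of radius [2 * a] the power has Lipschitz constant [D * a ^+ m]; division by
   [A >= a ^+ m.+1] leaves [D / a]. *)
pose D : R := m.+1%:R * 2 ^+ m.
have D1 : 0 < D by rewrite mulr_gt0// exprn_gt0.
(* For [a >= K] the first summands give [1 <= a] and [a + K0 <= 2 * a]. The last one makes
   [D / a * (K0 + tau^-1)] at most [1 / 320], which serves both hypotheses on [q]: [K0] for its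
   distance to 1, and [tau^-1], the Lipschitz constant of [W], for its variation. *)
pose K : R := 1 + K0 + tau^-1 + 320 * (D * (K0 + tau^-1)).
have ti0 : 0 < tau^-1 by rewrite invr_gt0.
have K1 : 1 <= K /\ K0 <= K /\ tau^-1 <= K /\ 320 * (D * (K0 + tau^-1)) <= K.
  have : 0 < D * (K0 + tau^-1) by rewrite mulr_gt0// addr_gt0.
  by rewrite /K; repeat split; lra.
exists K; first by case: K1.
move=> a c Ka c0; case: K1 => K1 [KK0 [Kt KD]].
have a1 : 1 <= a by lra.
pose P z := z ^+ m.+1 + c%:C.
pose W z : R[i] := a%:C + (tau^-1)%:C * (0 +i* pi + z).
have W_le z : cmod z <= 1 / 80 -> cmod (W z - a%:C) <= K0.
  move=> hz; rewrite /W addrC addKr cmodM cmodR gtr0_norm// /K0 mulrC.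
  rewrite ler_pM2r//; apply: (le_trans (cmodD _ _)).
  have -> : cmod (0 +i* pi : R[i]) = pi.
    by rewrite cmodE/= expr0n add0r sqrtr_sqr gtr0_norm.
  by lra.
have Wle2 z : cmod z <= 1 / 80 -> cmod (W z) <= a + K0.
  move=> hz; have -> : W z = a%:C + (W z - a%:C) by ring.
  apply: (le_trans (cmodD _ _)); rewrite cmodR ger0_norm; last by lra.
  by rewrite lerD2l W_le.
have WB z w : W z - W w = (tau^-1)%:C * (z - w) by rewrite /W; ring.
pose A := a ^+ m.+1 + c.
have A_ge : a ^+ m.+1 <= A by rewrite lerDl.
have am0 : 0 < a ^+ m.+1 by rewrite exprn_gt0//; lra.
have A0 : 0 < A by exact: lt_le_trans A_ge.
have PL z w : cmod z <= 2 * a -> cmod w <= 2 * a ->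
    cmod (P z - P w) / A <= D / a * cmod (z - w).
  move=> hz hw; have -> : P z - P w = z ^+ m.+1 - w ^+ m.+1 by rewrite /P; ring.
  rewrite ler_pdivrMr//; apply: (le_trans (cmodXB m hz hw)).
  have -> : m.+1%:R * (2 * a) ^+ m * cmod (z - w) =
      D / a * cmod (z - w) * a ^+ m.+1.
    by rewrite exprMn exprS /D; field; apply/eqP; lra.
  by rewrite ler_wpM2l// mulr_ge0 ?cmod_ge0// divr_ge0 ?ltW//; lra.
have Da0 : 0 <= D / a by rewrite divr_ge0 ?ltW//; lra.
have DK : D / a * (K0 + tau^-1) <= 1 / 320.
  have : 320 * (D * (K0 + tau^-1)) <= a by lra.
  move=> h; rewrite mulrAC ler_pdivrMr; last by lra.
  by rewrite mul1r -ler_pdivrMl//; lra.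
have DK0 : 0 <= D / a * K0 by rewrite mulr_ge0// ltW.
have Dt0 : 0 <= D / a * tau^-1 by rewrite mulr_ge0// ltW.
rewrite mulrDr in DK.
pose q z := P (W z) / A%:C.
have cA (x : R[i]) : cmod (x / A%:C) = cmod x / A.
  by rewrite -rmorphV ?unitfE ?gt_eqF// cmodM cmodR gtr0_norm// invr_gt0.
have AC : A%:C != 0.
  by rewrite -(rmorph0 (real_complex R)) (inj_eq (@complexI _)) gt_eqF.
have PA : P a%:C = A%:C by rewrite /P /A rmorphD/= rmorphXn.
have q1 z : cmod z <= 1 / 80 -> cmod (q z - 1) <= 1 / 320.
  move=> hz; have -> : q z - 1 = (P (W z) - P a%:C) / A%:C.
    by rewrite /q PA mulrBl divff.
  rewrite cA; apply: le_trans (PL _ _ _ _) _.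
  - by apply: (le_trans (Wle2 _ hz)); lra.
  - by rewrite cmodR ger0_norm; lra.
  have := ler_wpM2l Da0 (W_le _ hz); lra.
have qL z w : cmod z <= 1 / 80 -> cmod w <= 1 / 80 ->
    cmod (q z - q w) <= 1 / 320 * cmod (z - w).
  move=> hz hw; have -> : q z - q w = (P (W z) - P (W w)) / A%:C.
    by rewrite /q mulrBl.
  rewrite cA; apply: le_trans (PL _ _ _ _) _.
  - by apply: (le_trans (Wle2 _ hz)); lra.
  - by apply: (le_trans (Wle2 _ hw)); lra.
  rewrite WB cmodM cmodR gtr0_norm// mulrA ler_wpM2r ?cmod_ge0//; lra.
have [z hz zE] := cexpM_near1_root q1 qL.
exists (W z); split.
- have := le_trans (abs_Re_le_cmod _) (W_le _ hz);
  rewrite ler_norml => /andP[+ _].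
  by rewrite raddfB/=; lra.
- by apply: (le_trans (Wle2 _ hz)); lra.
have -> : tau%:C * W z = (tau * a +i* pi) + z.
  rewrite /W mulrDr mulrA -!rmorphM/= mulfV ?gt_eqF// mul1r addrA;
    congr (_ + _).
  by apply/eqP; rewrite eq_complex/= addr0 add0r !eqxx.
rewrite cexpD cexp_pi.
have -> : W z ^+ m.+1 + c%:C = q z * A%:C by rewrite /q divfK.
rewrite rmorphM /=; set E := (expR _)%:C.
transitivity (- (cexp z * q z) * (A%:C * E)); first by ring.
by rewrite zE mulN1r.
Qed.

Lemma expR_monomial_solution m (tau c K lam : R) : 0 < tau ->
  0 <= c -> 1 <= K -> (K ^+ m.+1 + c) * expR (tau * K) <= lam ->
  exists2 a, K <= a & (a ^+ m.+1 + c) * expR (tau * a) = lam.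
Proof.
move=> tau0 c0 K1 Kl; pose f a := (a ^+ m.+1 + c) * expR (tau * a).
(* At [b] the exponential alone reaches [lam], because [expR (tau * b) >= tau * b >= lam], and the
   other factor is at least 1. The intermediate value theorem then applies on the segment from [K]
   to [b]. *)
pose b := Num.max K (lam / tau).
have Kb : K <= b by rewrite le_max lexx.
have fb : lam <= f b.
  have h1 : lam <= expR (tau * b).
    apply: le_trans (expR_ge1Dx _); apply: (@le_trans _ _ (tau * b));
      last by lra.
    by rewrite mulrC -ler_pdivrMr// le_max lexx orbT.
  apply: (le_trans h1); rewrite ler_peMl ?expR_ge0//.
  apply: (@le_trans _ _ (b ^+ m.+1)); last by lra.
  by rewrite exprn_ege1//; lra.
have cf : {within `[K, b], continuous f}.
  apply: continuous_subspaceT => x; rewrite /f; apply: cvgM.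
    by apply: cvgD; [exact: exprn_continuous|exact: cvg_cst].
  apply: continuous_comp; last exact: continuous_expR.
  exact: mulrl_continuous.
have fle : Num.min (f K) (f b) <= lam <= Num.max (f K) (f b).
  by rewrite ge_min Kl le_max fb orbT.
have [a] := IVT Kb cf fle; rewrite in_itv/= => /andP[Ka _] fa.
by exists a.
Qed.

End roots.

(** * Exponential solutions *)

Section hnorm_theory.
Context {R : realType} {V : normedModType R[i]}.
Implicit Types (u v : V) (z w : R[i]).

Lemma normr_hnorm u : `|u| = (hnorm u)%:C.
Proof. by rewrite /hnorm RRe_real// normr_real. Qed.

Lemma hnorm_ge0 u : 0 <= hnorm u.
Proof. by rewrite -ler0c -normr_hnorm. Qed.

Lemma hnormZ z u : hnorm (z *: u) = cmod z * hnorm u.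
Proof. by apply: (@complexI R); rewrite -normr_hnorm normrZ normCE normr_hnorm
  rmorphM. Qed.

(** Positive elements of [R[i]] are real, so real radii suffice. *)
Lemma cvg_hnorm (T : Type) (F : set_system T) (f : T -> V) (l : V) :
  Filter F -> (forall e : R, 0 < e -> \forall x \near F, hnorm (l - f x) < e) ->
  f @ F --> l.
Proof.
move=> FF h; apply/cvgrPdist_lt => e e0.
have eR : e = (Re e)%:C by rewrite RRe_real// gtr0_real.
move: e0; rewrite eR ltcR => e0.
by apply: filterS (h _ e0) => x; rewrite normr_hnorm ltcR.
Qed.

Lemma cmod_cexpB1_le z : cmod z <= 1 / 2 -> cmod (cexp z - 1) <= 3 * cmod z.
Proof.
move=> hz; have -> : cexp z - 1 = (cexp z - 1 - z) + z by ring.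
apply: (le_trans (cmodD _ _)); have := cmod_cexpB_le hz.
have := cmod_ge0 z; nra.
Qed.

Definition mode w v (t : R) : V := cexp (w * t%:C) *: v.

Lemma modeD w v t h : mode w v (t + h) = cexp (w * h%:C) *: mode w v t.
Proof. by rewrite /mode scalerA -cexpD; congr (cexp _ *: _); rewrite rmorphD/=;
  ring. Qed.

Lemma hnorm_mode w v t : hnorm (mode w v t) = expR (Re w * t) * hnorm v.
Proof. by rewrite /mode hnormZ cmod_cexp; case: w => a b /=;
  rewrite mulr0 subr0. Qed.

Lemma mode_continuous w v : continuous (mode w v).
Proof.
move=> t; apply: cvg_hnorm => e e0.
pose B := cmod w + 1; have B0 : 0 < B by have := cmod_ge0 w; rewrite /B; lra.
pose C := hnorm (mode w v t) + 1.
have C0 : 0 < C by have := hnorm_ge0 (mode w v t); rewrite /C; lra.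
(* The first bound brings [w * h] into the range of [cmod_cexpB1_le], the second makes the resulting
   estimate smaller than [e]; the added ones keep [B] and [C] positive. *)
pose d := Num.min (1 / 2 / B) (e / (3 * B * C)).
have d0 : 0 < d by rewrite lt_min !divr_gt0 ?mulr_gt0//; lra.
apply/nbhs_ballP; exists d => //= s; rewrite /ball/= distrC lt_min =>
  /andP[h1 h2].
have -> : s = t + (s - t) by ring.
rewrite modeD; set h := s - t in h1 h2 *.
have -> : mode w v t - cexp (w * h%:C) *: mode w v t =
    (1 - cexp (w * h%:C)) *: mode w v t.
  by rewrite scalerBl scale1r.
rewrite hnormZ -cmodN opprB.
rewrite ltr_pdivlMr// in h1; rewrite ltr_pdivlMr ?mulr_gt0// in h2.
have hwh : cmod (w * h%:C) <= `|h| * B.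
  by rewrite cmodM cmodR mulrC ler_wpM2l// /B; lra.
have h3 : cmod (w * h%:C) <= 1 / 2 by lra.
apply: le_lt_trans h2; have -> : `|h| * (3 * B * C) = 3 * (`|h| * B) * C.
  by ring.
apply: ler_pM; rewrite ?cmod_ge0 ?hnorm_ge0//; last by rewrite /C; lra.
by have := cmod_cexpB1_le h3; lra.
Qed.

(** Small positive increments are always admissible, also at [t = 0]. Properness is what makes the
    limit in [deriv_t] unique. *)
Lemma half_dnbhs0_proper (t : R) : 0 <= t ->
  ProperFilter (within [set h : R | 0 <= t + h] (0 : R)^').
Proof.
move=> t0; apply: Build_ProperFilter_ex => P.
rewrite /within/= /dnbhs /within /= => /nbhs_ballP [e /= e0 h].
exists (e / 2); apply: h; rewrite ?gt_eqF ?divr_gt0//=;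
  last by rewrite addr_ge0// divr_ge0// ltW.
by rewrite /ball/= sub0r normrN gtr0_norm ?divr_gt0//; lra.
Qed.

(* [deriv_t] is junk at negative times, so the iterated derivatives of a mode
   are known on [[0, +oo[] only. *)
Lemma mode_dquot w v (f : R -> V) (t : R) : 0 <= t ->
  (forall s : R, 0 <= s -> f s = mode w v s) ->
  dquot f t h @[h --> within [set h : R | 0 <= t + h] (0 : R)^'] -->
    w *: mode w v t.
Proof.
move=> t0 fE; have FF := half_dnbhs0_proper t0.
apply: cvg_hnorm => e e0.
pose B := cmod w + 1; have B0 : 0 < B by have := cmod_ge0 w; rewrite /B; lra.
pose C := hnorm (mode w v t) + 1.
have C0 : 0 < C by have := hnorm_ge0 (mode w v t); rewrite /C; lra.
(* The quadratic remainder of [cexp], divided by the increment [h], is still of order [4 * B ^+ 2]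
   times the modulus of [h]. *)
pose d := Num.min (1 / 2 / B) (e / (4 * B ^+ 2 * C)).
have B20 : 0 < B ^+ 2 by rewrite exprn_gt0.
have d0 : 0 < d by rewrite lt_min !divr_gt0 ?mulr_gt0//; lra.
rewrite /within/= /dnbhs /within /=; apply/nbhs_ballP; exists d => //= h.
rewrite /ball/= sub0r normrN lt_min => /andP[h1 h2] hn0 th0.
rewrite /dquot !fE// modeD.
have -> : cexp (w * h%:C) *: mode w v t - mode w v t =
    (cexp (w * h%:C) - 1) *: mode w v t.
  by rewrite scalerBl scale1r.
have -> (M : V) (a b : R[i]) : w *: M - a *: (b *: M) = (w - a * b) *: M.
  by rewrite scalerBl scalerA.
rewrite hnormZ.
have hC0 : h%:C != 0 by rewrite -(rmorph0 (real_complex R))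
  (inj_eq (@complexI _)).
have -> : w - (h%:C)^-1 * (cexp (w * h%:C) - 1) =
    - ((h%:C)^-1 * (cexp (w * h%:C) - 1 - w * h%:C)) by field.
rewrite cmodN cmodM -rmorphV ?unitfE//= cmodR normfV.
rewrite ltr_pdivlMr// in h1; rewrite ltr_pdivlMr ?mulr_gt0// in h2.
have hwh : cmod (w * h%:C) <= `|h| * B.
  by rewrite cmodM cmodR mulrC ler_wpM2l// /B; lra.
have h3 : cmod (w * h%:C) <= 1 / 2 by lra.
apply: le_lt_trans h2; have hp : 0 < `|h| by rewrite normr_gt0.
have -> : `|h| * (4 * B ^+ 2 * C) = `|h|^-1 * (4 * (`|h| * B) ^+ 2) * C.
  by field; rewrite gt_eqF.
apply: ler_pM; rewrite ?hnorm_ge0 ?mulr_ge0 ?invr_ge0 ?cmod_ge0//;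
  last by rewrite /C; lra.
rewrite ler_wpM2l ?invr_ge0//; apply: (le_trans (cmod_cexpB_le h3)).
by rewrite ler_pM2l// lerXn2r// nnegrE ?cmod_ge0// mulr_ge0// ltW.
Qed.

Lemma mode_derivable_t w v (f : R -> V) (t : R) : 0 <= t ->
  (forall s : R, 0 <= s -> f s = mode w v s) -> derivable_t f t.
Proof. by move=> t0 fE; apply/cvg_ex; exists (w *: mode w v t);
  exact: mode_dquot. Qed.

Lemma mode_deriv_t w v (f : R -> V) (t : R) : 0 <= t ->
  (forall s : R, 0 <= s -> f s = mode w v s) -> deriv_t f t = w *: mode w v t.
Proof.
move=> t0 fE; have FF := half_dnbhs0_proper t0.
by apply: cvg_lim; [exact: norm_hausdorff|exact: mode_dquot].
Qed.

Lemma mode_derivn_t w v k (t : R) : 0 <= t ->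
  derivn_t k (mode w v) t = mode w (w ^+ k *: v) t.
Proof.
elim: k t => [|k IH] t t0; first by rewrite expr0 scale1r.
rewrite [LHS](mode_deriv_t t0 IH) /mode exprS -(scalerA w).
by rewrite [LHS]scalerA mulrC -scalerA.
Qed.

End hnorm_theory.

(** * Square integrability of the history *)

Section measurability.
Context {R : realType} {V : normedModType R[i]}.

(* Compose [f] with simple functions approximating the identity. *)
Lemma continuous_strongly_measurable (a b : R) (f : R -> V) :
  continuous f -> strongly_measurable `]a, b[ f.
Proof.
(* The shift by [a] makes the identity nonnegative on the interval, as approximation by nonnegative
   simple functions requires. *)
move=> cf; pose g (t : R) : \bar R := (t - a)%:E.
have mg : measurable_fun `]a, b[ g.
  by apply/measurable_EFinP; exact: measurable_funB.
pose h := nnsfun_approx (measurable_itv `]a, b[) mg.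
exists (fun n t => f (a + h n t)); split.
  move=> n; split.
    apply: (@sub_finite_set _ _ ((fun x => f (a + x)) @` range (h n))).
      by move=> _ [t _ <-]; exists (h n t) => //; exists t.
    by apply: finite_image; exact: fimfunP.
  move=> x; apply: measurableI => //.
  (* Intersecting with the finite range of [h n] presents the level set as the preimage of a finite
     set, hence of a measurable one. *)
  pose B := range (h n) `&` [set y | f (a + y) = x].
  have -> : (fun t => f (a + h n t)) @^-1` [set x] = h n @^-1` B.
    by apply/seteqP; split => t /=; [move=> ?; split => //; exists t|case].
  apply: measurable_funPTI.
  apply: countable_measurable; first by move=> y; exact: measurable_set1.
  apply: finite_set_countable.
  by apply: sub_finite_set (fimfunP (h n)) => ? [].
apply: aeW => t abt.
apply: (@cvg_comp _ _ _ (fun n => a + h n t) f _ (nbhs t)); last exact: cf.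
have -> : nbhs t = nbhs (a + (t - a)) by congr nbhs; ring.
apply: cvgD; first exact: cvg_cst.
under eq_cvg do rewrite nnsfun_approxE.
apply: (@cvg_approx _ _ _ _ g t _ abt); last exact: ltry.
by move=> s; rewrite /= in_itv/= => /andP[? _]; rewrite lee_fin subr_ge0 ltW.
Qed.

End measurability.

Section history.
Context {R : realType} {V : normedModType R[i]}.

(** At negative times [expR (Re w * t) <= 1], so a growing mode is dominated on its history by the
    constant [hnorm v], on an interval of length [tau]. *)
Lemma mode_L2_le (w : R[i]) (v : V) (tau : R) : 0 < tau -> 0 <= Re w ->
  (L2_sqnorm `](- tau)%R, 0%R[ (mode w v) <= (hnorm v ^+ 2 * tau)%:E)%E.
Proof.
move=> tau0 w0; pose I : set R := [set` `]- tau, 0[].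
have muI : (lebesgue_measure I = tau%:E)%E.
  by rewrite /I lebesgue_measure_itv/= lte_fin oppr_lt0 tau0 -EFinD sub0r opprK.
have -> : (hnorm v ^+ 2 * tau)%:E =
    (\int[@lebesgue_measure R]_(t in I) cst (hnorm v ^+ 2)%:E t)%E.
  rewrite integral_cst; last exact: measurable_itv.
  by rewrite EFinM; congr (_ * _)%E; exact/esym.
rewrite /L2_sqnorm; apply: ge0_le_integral => //.
- by move=> t _; rewrite lee_fin sqr_ge0.
- apply/measurable_EFinP; apply: measurable_funTS.
  under eq_fun do rewrite hnorm_mode.
  apply: continuous_measurable_fun => t; apply: cvgM; last first.
    apply: cvgM; last exact: cvg_cst.
    apply: continuous_comp; last exact: continuous_expR.
    exact: mulrl_continuous.
  apply: cvgM; last exact: cvg_cst.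
  apply: continuous_comp; last exact: continuous_expR.
  exact: mulrl_continuous.
- move=> t; rewrite /= in_itv/= => /andP[_ t0]; rewrite lee_fin hnorm_mode.
  rewrite lerXn2r// ?nnegrE ?mulr_ge0 ?expR_ge0 ?hnorm_ge0//.
  by rewrite ler_piMl ?hnorm_ge0// -expR0 ler_expR mulr_ge0_le0// ltW.
Qed.

Lemma mode_in_L2 (w : R[i]) (v : V) (tau : R) : 0 < tau -> 0 <= Re w ->
  in_L2 `]- tau, 0[ (mode w v).
Proof.
move=> tau0 w0; split.
  by apply: continuous_strongly_measurable; exact: mode_continuous.
by apply: le_lt_trans (mode_L2_le v tau0 w0) _; exact: ltry.
Qed.

End history.

(** * Exponential solutions along an eigenfunction *)

Section eigenmodes.
Context {R : realType} {H : hilbertSpace R} (A : eigenOperator H).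
Implicit Types (z w : R[i]) (j : nat).

Lemma hnorm_eigfun j : hnorm (eigfun A j) = 1.
Proof.
have [on _] := eigfun_complete A; have := on j j;
  rewrite eqxx inner_norm normr_hnorm.
rewrite -rmorphXn/= => /(congr1 Re)/= /eqP;
  rewrite sqrf_eq1 => /orP[/eqP//|/eqP h].
by have := hnorm_ge0 (eigfun A j); rewrite h; lra.
Qed.

Lemma op0 : A 0 = 0.
Proof.
have := @opP _ _ A 1 0 0 (dom0 A) (dom0 A); rewrite !scale1r addr0.
by move=> /eqP; rewrite -subr_eq subrr eq_sym => /eqP.
Qed.

Lemma dom_eigfun z j : dom A (z *: eigfun A j).
Proof. by rewrite -[_ *: _]addr0; apply: domP;
  [exact: eigfun_dom|exact: dom0]. Qed.

Lemma op_eigfun z j : A (z *: eigfun A j) = (z * (eigval A j)%:C) *: eigfun A j.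
Proof.
rewrite -[z *: _]addr0 opP; [|exact: eigfun_dom|exact: dom0].
by rewrite op0 addr0 eigfunP scalerA.
Qed.

(** By orthonormality the partial sums are stationary once they contain the index [j]; membership in
    [fpow_dom] and the value of [fpow] follow from this. *)
Lemma fpow_series_eigfun alpha z j n : (j < n)%N ->
  fpow_series A alpha (z *: eigfun A j) n =
    (((- eigval A j) `^ alpha)%:C * z) *: eigfun A j.
Proof.
move=> jn; rewrite /fpow_series /series/= big_mkord (bigD1 (Ordinal jn))//=.
rewrite linearZl_LR/=; have [on _] := eigfun_complete A.
rewrite on eqxx mulr1 big1 ?addr0// => i ij.
rewrite linearZl_LR/= on (_ : (j == i) = false) ?mulr0 ?scale0r//.
by apply: contraNF ij => /eqP ji; apply/eqP/val_inj.
Qed.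

Lemma fpow_dom_eigfun alpha z j : fpow_dom A alpha (z *: eigfun A j).
Proof.
apply: (@is_cvg_near_cst _ _ (((- eigval A j) `^ alpha)%:C * z *: eigfun A j)).
by exists j.+1 => // n /= jn; rewrite fpow_series_eigfun.
Qed.

Lemma fpow_eigfun alpha z j : fpow A alpha (z *: eigfun A j) =
  (((- eigval A j) `^ alpha)%:C * z) *: eigfun A j.
Proof.
apply: lim_near_cst; first exact: norm_hausdorff.
by exists j.+1 => // n /= jn; rewrite fpow_series_eigfun.
Qed.

(** The same exponential formula also gives the history, so the delay multiplies the mode by
    [cexp (- (tau%:C * w))]. The equation is then the characteristic equation multiplied by this
    factor. *)
Lemma eigenmode_solution m j (tau eps alpha : R) w z : 0 < tau -> 0 <= Re w ->
  (w ^+ m.+1 + (eps * (- eigval A j) `^ alpha)%:C) * cexp (tau%:C * w) =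
    (eigval A j)%:C ->
  is_solution A m.+1 tau eps alpha (mode w (z *: eigfun A j)).
Proof.
move=> tau0 w0 charE; set v := z *: eigfun A j.
have modeE t : mode w v t = (cexp (w * t%:C) * z) *: eigfun A j.
  by rewrite /mode scalerA.
have cont k (D : set R) : D `<=` `[0, +oo[ ->
    {within D, continuous (derivn_t k (mode w v))}.
  move=> D0; apply: (@subspace_eq_continuous _ _ _ (mode w (w ^+ k *: v))).
    by move=> t; rewrite inE => /D0; rewrite /= in_itv/= andbT => t0;
      exact/esym/mode_derivn_t.
  by apply: continuous_subspaceT; exact: mode_continuous.
split=> /=.
- exact: mode_in_L2.
- by move=> k t _ t0; apply: mode_derivable_t => // s s0; exact: mode_derivn_t.
- exact: cont.
- move=> t t0; apply: mode_derivable_t; first exact: ltW.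
  by move=> s s0; exact: mode_derivn_t.
- by apply: (cont m.+1) => t; rewrite /= !in_itv/= !andbT; exact: ltW.
- by move=> t _; rewrite modeE; exact: dom_eigfun.
- by move=> t _; rewrite modeE; exact: fpow_dom_eigfun.
move=> t t0; rewrite [LHS](mode_derivn_t w v m.+1 (ltW t0)) !modeE op_eigfun
  fpow_eigfun.
rewrite /mode /v !scalerA -scalerBl; congr (_ *: _).
have -> : cexp (w * (t - tau)%:C) = cexp (w * t%:C) * cexp (- (tau%:C * w)).
  by rewrite -cexpD; congr cexp; rewrite rmorphB/=; ring.
rewrite -charE rmorphM/=; set E := cexp (w * _); set L := (_ `^ _)%:C.
have := cexpNK (tau%:C * w); set F := cexp _; set G := cexp _ => FG.
transitivity (E * z * ((w ^+ m.+1 + eps%:C * L) * (F * G) - eps%:C * L));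
  last by ring.
by rewrite FG; ring.
Qed.

End eigenmodes.

(** * Ill-posedness for an arbitrary operator *)

Section ill_posedness.
Context {R : realType}.

Lemma powR_le_near_infty (tau eps alpha K : R) m :
  0 < eps -> alpha < 1 -> 0 <= K ->
  exists L, forall lam, L <= lam ->
    (K ^+ m.+1 + eps * lam `^ alpha) * expR (tau * K) <= lam.
Proof.
move=> eps0 alpha1 K0; pose E := expR (tau * K).
have E0 : 0 < E by exact: expR_gt0.
have KE : 0 <= K ^+ m.+1 * E by rewrite mulr_ge0 ?exprn_ge0// ltW.
pose b := 2 * eps * E; have b0 : 0 < b by rewrite !mulr_gt0.
pose L1 := b `^ (1 - alpha)^-1.
exists (2 * (K ^+ m.+1 * E) + L1 + 1) => lam Ll.
have L10 : 0 <= L1 by exact: powR_ge0.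
have lam0 : 0 < lam by lra.
have h : b <= lam `^ (1 - alpha).
  have -> : b = L1 `^ (1 - alpha).
    by rewrite -powRrM mulVf ?gt_eqF ?subr_gt0// powRr1// ltW.
  by rewrite ge0_ler_powR ?nnegrE// ?subr_ge0; lra.
have -> : (K ^+ m.+1 + eps * lam `^ alpha) * E =
    K ^+ m.+1 * E + (b * lam `^ alpha) / 2.
  by rewrite /b; field.
suff : b * lam `^ alpha <= lam by lra.
apply: (@le_trans _ _ (lam `^ (1 - alpha) * lam `^ alpha)).
  by rewrite ler_wpM2r// powR_ge0.
rewrite -powRD; first by rewrite subrK powRr1 ?(ltW lam0).
by apply/implyP => _; exact: lt0r_neq0.
Qed.

Lemma ill_posed_eigenOperator (H : hilbertSpace R) (A : eigenOperator H) m
  (tau eps alpha : R) : 0 < tau -> 0 < eps -> alpha < 1 ->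
  ill_posed A m.+1 tau eps alpha.
Proof.
move=> tau0 eps0 alpha1; have [K K1 rootP] := char_root_near m tau0.
have K0 : 0 <= K by lra.
(* Since [cmod w <= a + K] and [1 <= a + K], this amplitude compensates every factor [w ^+ k] with
   [k <= m] in the initial derivatives. *)
pose rho a : R := (a + K)^-1 ^+ m.+1.
(* The term [3 * K] gives [a - K >= (a + K) / 2], hence [Re w >= (a + K) / 2]; the term [n%:R]
   drives the growth along the sequence. *)
have modes n : exists j a w,
  [/\ 3 * K + n%:R <= a, a - K <= Re w, cmod w <= a + K &
    (w ^+ m.+1 + (eps * (- eigval A j) `^ alpha)%:C) * cexp (tau%:C * w) =
    (eigval A j)%:C].
  have n0 : 0 <= n%:R :> R by [].
  pose Kn := 3 * K + n%:R.
  have Kn0 : 0 <= Kn by rewrite /Kn; lra.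
  have [L LP] := @powR_le_near_infty tau eps alpha Kn m eps0 alpha1 Kn0.
  have [N _ /(_ N (leqnn N)) /=] :=
    cvgrNy_ler (@eigval_cvg _ _ A) (num_real (- Num.max L 1)).
  rewrite lerNr ge_max => /andP[Llam _].
  have Kn1 : 1 <= Kn by rewrite /Kn; lra.
  have c0 : 0 <= eps * (- eigval A N) `^ alpha.
    by rewrite mulr_ge0 ?powR_ge0// ltW.
  have [a Ka aE] := expR_monomial_solution tau0 c0 Kn1 (LP _ Llam).
  have aK : K <= a by move: Ka; rewrite /Kn; lra.
  have [w [w1 w2 wE]] := rootP _ _ aK c0.
  by exists N, a, w; split => //; rewrite wE aE rmorphN opprK.
have [j /choice[a /choice[w aw]]] := choice modes.
have n0 n : 0 <= n%:R :> R by [].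
have x1 n : 1 <= a n + K by have [? _ _ _] := aw n; have := n0 n; lra.
have Kx n : 3 * K + n%:R + K <= a n + K by have [? _ _ _] := aw n; lra.
have x0 n : 0 < a n + K by have := x1 n; lra.
have w0 n : 0 <= Re (w n) by have [? ? _ _] := aw n; have := n0 n; lra.
have rho0 n : 0 <= rho (a n) by rewrite exprn_ge0// invr_ge0 ltW.
have hrho n : hnorm ((rho (a n))%:C *: eigfun A (j n)) = rho (a n).
  by rewrite hnormZ hnorm_eigfun mulr1 cmodR ger0_norm.
have rho1 n : rho (a n) <= 1.
  by rewrite exprn_ile1 ?invr_ge0 ?(ltW (x0 n))// invf_le1.
exists (fun n => mode (w n) ((rho (a n))%:C *: eigfun A (j n))); split.
- by move=> n; have [_ _ _ ?] := aw n; exact: eigenmode_solution.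
- move=> t t0; pose C := (t / 2 / m.+2%:R) ^+ m.+2.
  have C0 : 0 < C by rewrite exprn_gt0// !divr_gt0.
  (* The norm at time [t] will turn out to be at least [n%:R * C], so every [n] beyond [B / C]
     works. *)
  apply/cvgryPge => B; exists `|Num.ceil (B / C)|%N => // n /= Bn.
  have BCn : B <= n%:R * C.
    rewrite -ler_pdivrMr//; apply: (le_trans (ceil_ge _)).
    by rewrite -[n%:R]/(n%:Z%:~R) ler_int (le_trans (ler_norm _))// -abszE
      lez_nat.
  apply: (le_trans BCn); rewrite hnorm_mode hrho.
  pose x := a n + K.
  (* [exp y >= (y / (m + 2)) ^ (m + 2)] beats the factor [x ^ (m + 1)]. *)
  have ex : (x * (t / 2 / m.+2%:R)) ^+ m.+2 <= expR (Re (w n) * t).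
    apply: (@le_trans _ _ (expR (x * (t / 2 / m.+2%:R)) ^+ m.+2)).
      rewrite lerXn2r// ?nnegrE ?expR_ge0 ?mulr_ge0 ?divr_ge0 ?(ltW t0)
        ?(ltW (x0 n))//.
      by apply: le_trans (expR_ge1Dx _); rewrite lerDr.
    rewrite -expRM_natl ler_expR.
    have -> : m.+2%:R * (x * (t / 2 / m.+2%:R)) = x / 2 * t by field.
    rewrite ler_wpM2r ?(ltW t0)//; have [? ? _ _] := aw n.
    by have := n0 n; rewrite /x; lra.
  apply: (@le_trans _ _ ((x * (t / 2 / m.+2%:R)) ^+ m.+2 * rho (a n)));
    last first.
    by rewrite ler_wpM2r.
  have xm0 : x ^+ m.+1 != 0 by rewrite expf_neq0// gt_eqF// x0.
  rewrite exprMn -/C exprS /rho -/x exprVn.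
  have -> : x * x ^+ m.+1 * C / x ^+ m.+1 = x * C by rewrite mulrAC mulfK.
  by rewrite ler_wpM2r ?(ltW C0)//; have := Kx n; rewrite /x; lra.
(* Each of the [m.+1] initial derivatives has norm at most 1, and the history has squared norm at
   most [rho (a n) ^+ 2 * tau <= tau]. *)
exists (Num.sqrt (m.+1%:R + tau)) => n; rewrite /data_norm ler_wsqrtr// lerD//.
  have -> : m.+1%:R = \sum_(k < m.+1) 1 :> R by rewrite sumr_const card_ord.
  apply: ler_sum => k _; rewrite mode_derivn_t// hnorm_mode mulr0 expR0 mul1r.
  rewrite exprn_ile1 ?hnorm_ge0// hnormZ hrho cmodX.
  have [_ _ wx _] := aw n.
  apply: (@le_trans _ _ ((a n + K) ^+ k * rho (a n))).
    by rewrite ler_wpM2r// lerXn2r// ?nnegrE ?cmod_ge0// ltW.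
  rewrite /rho exprVn ler_pdivrMr ?exprn_gt0// mul1r.
  by rewrite ler_weXn2l// ltnW.
have := mode_L2_le ((rho (a n))%:C *: eigfun A (j n)) tau0 (w0 n).
rewrite hrho => h.
have h0 : (0 <= L2_sqnorm `](- tau)%R, 0%R[
    (mode (w n) ((rho (a n))%:C *: eigfun A (j n))))%E.
  by apply: integral_ge0 => t _; rewrite lee_fin sqr_ge0.
have hf : L2_sqnorm `](- tau), 0[
    (mode (w n) ((rho (a n))%:C *: eigfun A (j n))) \is a fin_num.
  by rewrite ge0_fin_numE// (le_lt_trans h)// ltry.
rewrite -lee_fin fineK//; apply: (le_trans h); rewrite lee_fin.
by rewrite ler_piMl ?(ltW tau0)// exprn_ile1.
Qed.

End ill_posedness.

(** * The Hilbert space l^2 *)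

Section complex_series.
Context {R : realType}.
Implicit Types (f g : nat -> R[i]) (s a : R[i]) (u : nat -> R).

Definition bounded_sums u := exists M, forall n, \sum_(k < n) u k <= M.

(** Split into coordinates so that the theory of real series applies. *)
Definition has_csum f s :=
  series (fun n => Re (f n)) @ \oo --> Re s /\
  series (fun n => Im (f n)) @ \oo --> Im s.

Definition csum f : R[i] :=
  limn (series (fun n => Re (f n))) +i* limn (series (fun n => Im (f n))).

Lemma bounded_sums_cvg u : (forall n, 0 <= u n) -> bounded_sums u ->
  cvgn (series u).
Proof.
move=> u0 [M uM]; apply: nondecreasing_is_cvgn.
  by apply: nondecreasing_series => n _ _; exact: u0.
by exists M => _ [n _ <-]; rewrite /series/= big_mkord.
Qed.

Lemma has_csum_csum f u : bounded_sums u -> (forall n, cmod (f n) <= u n) ->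
  has_csum f (csum f).
Proof.
move=> uM fu; have u0 n : 0 <= u n by exact: le_trans (cmod_ge0 _) (fu n).
have cu := bounded_sums_cvg u0 uM.
split; apply: (@normed_cvg R R^o); apply: series_le_cvg cu => //= n;
  apply: le_trans (fu n); [exact: abs_Re_le_cmod|exact: abs_Im_le_cmod].
Qed.

Lemma csum_unique f s : has_csum f s -> csum f = s.
Proof.
move=> [fr fi]; apply/eqP; rewrite eq_complex /csum/=.
by apply/andP; split; apply/eqP; apply: cvg_lim.
Qed.

Lemma has_csumD f g s t : has_csum f s -> has_csum g t ->
  has_csum (fun n => f n + g n) (s + t).
Proof.
move=> [fr fi] [gr gi]; split; rewrite raddfD/=.
  rewrite (_ : (fun n => _) = (fun n => Re (f n)) + (fun n => Re (g n))).
    by rewrite seriesD; exact: cvgD.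
  by apply/funext => n; rewrite !fctE/= raddfD.
rewrite (_ : (fun n => _) = (fun n => Im (f n)) + (fun n => Im (g n))).
  by rewrite seriesD; exact: cvgD.
by apply/funext => n; rewrite !fctE/= raddfD.
Qed.

Lemma has_csumZ a f s : has_csum f s -> has_csum (fun n => a * f n) (a * s).
Proof.
case: a s => a b [s t] [fr fi]; split => /=.
  rewrite (_ : (fun n => _) =
      a *: (fun n => Re (f n)) - b *: (fun n => Im (f n))).
    by rewrite seriesD seriesN !seriesZ; apply: cvgB; apply: (@cvgZr _ R^o).
  by apply/funext => n; rewrite !fctE/=; case: (f n).
rewrite (_ : (fun n => _) =
    a *: (fun n => Im (f n)) + b *: (fun n => Re (f n))).
  by rewrite seriesD !seriesZ; apply: cvgD; apply: (@cvgZr _ R^o).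
by apply/funext => n; rewrite !fctE/=; case: (f n).
Qed.

Lemma has_csumJ f s : has_csum f s -> has_csum (fun n => (f n)^*) s^*.
Proof.
case: s => s t [fr fi]; split => /=.
  rewrite (_ : (fun n => _) = (fun n => Re (f n)))//.
  by apply/funext => n; case: (f n).
rewrite (_ : (fun n => _) = - (fun n => Im (f n))).
  by rewrite seriesN; exact: cvgN.
by apply/funext => n; rewrite !fctE/=; case: (f n).
Qed.

Lemma has_csum_single f j : (forall n, n != j -> f n = 0) -> has_csum f (f j).
Proof.
move=> f0; have E (h : R[i] -> R) : h 0 = 0 ->
    series (fun n => h (f n)) @ \oo --> h (f j).
  move=> h0; apply: cvg_near_cst; exists j.+1 => // n /= jn.
  rewrite /series/= big_mkord (bigD1 (Ordinal jn))//= big1 ?addr0// => i ij.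
  by rewrite f0.
by split; exact: E.
Qed.

Lemma has_csum_ge0 f s : (forall n, 0 <= f n) -> has_csum f s -> 0 <= s.
Proof.
move=> f0 [fr fi]; rewrite lecE; apply/andP; split.
  apply/eqP; rewrite -(cvg_lim _ fi)//; apply: lim_near_cst => //.
  by apply: nearW => n; rewrite /series/= big1// => k _;
    rewrite (ger0_Im (f0 k)).
apply: (cvgr_to_ge fr); apply: nearW => n; rewrite /series/= sumr_ge0// => k _.
by have := f0 k; rewrite lecE => /andP[].
Qed.

End complex_series.

(** * Inner product, norm and completeness of l^2 *)

Section ell2_module.
Context (R : realType).
Implicit Types (x y : nat -> R[i]).

(** Square summability as boundedness of partial sums: such bounds can be checked on finite sums,
    also for a coordinatewise limit. *)
Definition ell2_pred : {pred (nat -> R[i])} :=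
  fun x => `[< bounded_sums (fun n => cmod (x n) ^+ 2) >].

Lemma ell2_predP x :
  reflect (bounded_sums (fun n => cmod (x n) ^+ 2)) (x \in ell2_pred).
Proof. by apply: (iffP idP) => /asboolP. Qed.

Lemma ell2_pred_submod : subsemimod_closed ell2_pred.
Proof.
split; [split|].
- by apply/ell2_predP; exists 0 => n; rewrite big1// => k _;
  rewrite cmod0 expr0n.
- move=> x y /ell2_predP[M xM] /ell2_predP[N yN]; apply/ell2_predP.
  exists (2 * (M + N)) => n; apply: (@le_trans _ _
     (2 * (\sum_(k < n) cmod (x k) ^+ 2 + \sum_(k < n) cmod (y k) ^+ 2))).
    rewrite -big_split mulr_sumr; apply: ler_sum => k _ /=.
    have := cmodD (x k) (y k); have := cmod_ge0 (x k + y k).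
    have := sqr_ge0 (cmod (x k) - cmod (y k)); have := cmod_ge0 (x k);
      have := cmod_ge0 (y k).
    rewrite fctE; nra.
  by rewrite ler_pM2l//; apply: lerD; [exact: xM|exact: yN].
move=> a x /ell2_predP[M xM]; apply/ell2_predP; exists (cmod a ^+ 2 * M) => n.
apply: (@le_trans _ _ (cmod a ^+ 2 * \sum_(k < n) cmod (x k) ^+ 2)).
  by rewrite mulr_sumr; apply: ler_sum => k _; rewrite -exprMn -cmodM.
by rewrite ler_wpM2l ?sqr_ge0//; exact: xM.
Qed.

HB.instance Definition _ := GRing.isSubmodClosed.Build R[i] (nat -> R[i])
  ell2_pred ell2_pred_submod.

Record ell2 := Ell2 {
  ell2_seq :> nat -> R[i];
  ell2_seqP : ell2_seq \in ell2_pred }.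

HB.instance Definition _ := [isSub of ell2 for ell2_seq].
HB.instance Definition _ := [Choice of ell2 by <:].
HB.instance Definition _ := [SubChoice_isSubLmodule of ell2 by <:].

Implicit Types (u v w : ell2).

Lemma ell2P u v : u =1 v -> u = v.
Proof. by move=> uv; apply: val_inj; apply/funext. Qed.

Lemma ell2D u v n : (u + v) n = u n + v n. Proof. by []. Qed.
Lemma ell2N u n : (- u) n = - u n. Proof. by []. Qed.
Lemma ell2Z a u n : (a *: u) n = a * u n. Proof. by []. Qed.

Definition ell2_inner u v : R[i] := csum (fun n => u n * (v n)^*).

Lemma ell2_inner_csum u v : has_csum (fun n => u n * (v n)^*) (ell2_inner u v).
Proof.
apply: (@has_csum_csum _ _ (fun n => cmod (u n) ^+ 2 + cmod (v n) ^+ 2)).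
  have /ell2_predP[M uM] := ell2_seqP u; have /ell2_predP[N vN] := ell2_seqP v.
  by exists (M + N) => n; rewrite big_split/=; apply: lerD;
    [exact: uM|exact: vN].
move=> n; rewrite cmodM.
have -> : cmod (v n)^* = cmod (v n).
  by case: (v n) => a b; rewrite !cmodE/= sqrrN.
have := sqr_ge0 (cmod (u n) - cmod (v n)); have := cmod_ge0 (u n);
  have := cmod_ge0 (v n); nra.
Qed.

Lemma ell2_inner_eq u v s : has_csum (fun n => u n * (v n)^*) s ->
  ell2_inner u v = s.
Proof. exact: csum_unique. Qed.

Lemma ell2_innerJ u v : ell2_inner u v = (ell2_inner v u)^*.
Proof.
apply: ell2_inner_eq; have := has_csumJ (ell2_inner_csum v u).
congr has_csum; apply/funext => n; case: (u n) (v n) => a b [c d].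
by apply/eqP; rewrite eq_complex/=; apply/andP; split; apply/eqP; ring.
Qed.

Lemma ell2_innerPl a u v w :
  ell2_inner (a *: u + v) w = a * ell2_inner u w + ell2_inner v w.
Proof.
apply: ell2_inner_eq.
have := has_csumD (has_csumZ a (ell2_inner_csum u w)) (ell2_inner_csum v w).
by congr has_csum; apply/funext => n; rewrite ell2D ell2Z; ring.
Qed.

Lemma ell2_innerPr a u v w :
  ell2_inner w (a *: u + v) = a^* * ell2_inner w u + ell2_inner w v.
Proof. by rewrite ell2_innerJ ell2_innerPl (ell2_innerJ w u) (ell2_innerJ w v)
  rmorphD rmorphM. Qed.

Lemma ell2_inner_bilinear : bilinear_for
  (GRing.Scale.Law.clone _ _ *%R _)
  (GRing.Scale.Law.clone _ _ (@Num.conj R[i] \; *%R) _) ell2_inner.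
Proof. by split=> [w|w] a u v; [exact: ell2_innerPl|exact: ell2_innerPr]. Qed.

HB.instance Definition _ := bilinear_isBilinear.Build R[i] ell2 ell2 R[i] _ _
  ell2_inner ell2_inner_bilinear.

Lemma ell2_inner_hermitian u v :
  ell2_inner u v = (-1) ^+ false * Num.conj (ell2_inner v u).
Proof. by rewrite mul1r; exact: ell2_innerJ. Qed.

HB.instance Definition _ := @isHermitianSesquilinear.Build R[i] ell2 false
  (@Num.conj R[i]) ell2_inner ell2_inner_hermitian.

Lemma ell2_inner_sqr u (L : R) :
  series (fun n => cmod (u n) ^+ 2) @ \oo --> L -> ell2_inner u u = L%:C.
Proof.
move=> uL; apply: ell2_inner_eq; split => /=.
  rewrite (_ : (fun n => _) = (fun n => cmod (u n) ^+ 2))//.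
  by apply/funext => n; rewrite sqr_cmod; case: (u n) => a b/=; ring.
rewrite (_ : (fun n => _) = (fun=> 0)); last first.
  by apply/funext => n; case: (u n) => a b/=; ring.
apply: cvg_near_cst; exists 0%N => // n _.
by rewrite /series/= big1.
Qed.

Definition ell2_sqn u : R := limn (series (fun n => cmod (u n) ^+ 2)).

Lemma ell2_sqn_cvg u : series (fun n => cmod (u n) ^+ 2) @ \oo --> ell2_sqn u.
Proof. by apply: bounded_sums_cvg => [n|];
  [exact: sqr_ge0|exact/ell2_predP/ell2_seqP]. Qed.

Lemma ell2_inner_sqn u : ell2_inner u u = (ell2_sqn u)%:C.
Proof. exact/ell2_inner_sqr/ell2_sqn_cvg. Qed.

Lemma ell2_sum_le_sqn u n : \sum_(k < n) cmod (u k) ^+ 2 <= ell2_sqn u.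
Proof.
have := @nondecreasing_cvgn_le R (series (fun n => cmod (u n) ^+ 2)).
rewrite /series/= => /(_ _ _ n); rewrite big_mkord; apply;
  last exact: ell2_sqn_cvg.
by apply: nondecreasing_series => k _ _; exact: sqr_ge0.
Qed.

Lemma ell2_sqn_le u M : (forall n, \sum_(k < n) cmod (u k) ^+ 2 <= M) ->
  ell2_sqn u <= M.
Proof.
move=> uM; apply: limr_le; first exact: ell2_sqn_cvg.
by apply: nearW => n; rewrite /series/= big_mkord.
Qed.

Lemma cmod_le_ell2_sqn u n : cmod (u n) ^+ 2 <= ell2_sqn u.
Proof.
apply: le_trans (ell2_sum_le_sqn u n.+1).
by rewrite big_ord_recr/= lerDr sumr_ge0// => k _; exact: sqr_ge0.
Qed.

Lemma ell2_sqn_ge0 u : 0 <= ell2_sqn u.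
Proof. exact: le_trans (sqr_ge0 _) (cmod_le_ell2_sqn u 0). Qed.

Lemma ell2_inner_gt0 u : u != 0 -> 0 < ell2_inner u u.
Proof.
move=> u0; rewrite ell2_inner_sqn ltcR lt_neqAle ell2_sqn_ge0 andbT eq_sym.
apply: contraNneq u0 => s0; apply/eqP/ell2P => n.
have := cmod_le_ell2_sqn u n; rewrite s0 => h.
have : cmod (u n) ^+ 2 = 0 by apply/eqP; rewrite eq_le h sqr_ge0.
by move=> /eqP; rewrite expf_eq0/= => /eqP/cmod_eq0.
Qed.

HB.instance Definition _ := isDotProduct.Build R[i] ell2 ell2_inner
  ell2_inner_gt0.

Lemma ell2_sqn_inner u : ell2_sqn u = Re (ell2_inner u u).
Proof. by rewrite ell2_inner_sqn. Qed.

(** Used three times: for the Cauchy-Schwarz inequality, for the triangle inequality and for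
    Pythagoras in [diag_dom_dense]. *)
Lemma ell2_sqn_comb (a c : R) u v : ell2_sqn (a%:C *: u + c%:C *: v) =
  a ^+ 2 * ell2_sqn u + 2 * (a * c) * Re (ell2_inner u v) + c ^+ 2 * ell2_sqn v.
Proof.
rewrite ell2_sqn_inner ell2_innerPl !ell2_innerPr.
have Zl w : ell2_inner (c%:C *: v) w = c%:C * ell2_inner v w.
  exact: linearZl_LR.
have Zr w : ell2_inner w (c%:C *: v) = (c%:C)^* * ell2_inner w v.
  exact: linearZr_LR.
rewrite !(Zl, Zr) !ell2_inner_sqn (ell2_innerJ v u).
by case: (ell2_inner u v) => p q /=; ring.
Qed.

(** The squared norm of [ell2_sqn v] times [u] minus [Re (ell2_inner u v)] times [v] is nonnegative
    and factors through [ell2_sqn v]. The real part is all that the triangle inequality involves. *)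
Lemma ell2_cauchy_schwarz u v :
  Re (ell2_inner u v) ^+ 2 <= ell2_sqn u * ell2_sqn v.
Proof.
have := ell2_sqn_ge0 ((ell2_sqn v)%:C *: u + (- Re (ell2_inner u v))%:C *: v).
have [v0|v0] := eqVneq v 0.
  have -> : Re (ell2_inner u v) = 0 by rewrite v0 linear0r.
  by rewrite expr0n mulr_ge0// ell2_sqn_ge0.
have : 0 < ell2_sqn v by have := ell2_inner_gt0 v0; rewrite ell2_inner_sqn ltcR.
rewrite ell2_sqn_comb; move: (ell2_sqn u) (ell2_sqn v) (Re _) => a b p b0.
have -> : b ^+ 2 * a + 2 * (b * - p) * p + (- p) ^+ 2 * b =
    b * (a * b - p ^+ 2) by ring.
by rewrite pmulr_rge0// subr_ge0.
Qed.

Definition ell2_norm u : R[i] := (Num.sqrt (ell2_sqn u))%:C.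

Lemma ell2_ler_normD u v : ell2_norm (u + v) <= ell2_norm u + ell2_norm v.
Proof.
rewrite /ell2_norm -rmorphD lecR.
rewrite -(@ler_pXn2r _ 2)// ?nnegrE ?addr_ge0 ?sqrtr_ge0// sqrrD !sqr_sqrtr
  ?ell2_sqn_ge0//.
have := ell2_sqn_comb 1 1 u v; rewrite !scale1r !expr1n !mul1r => ->.
have : `|Re (ell2_inner u v)| <= Num.sqrt (ell2_sqn u) * Num.sqrt (ell2_sqn v).
  by rewrite -sqrtrM ?ell2_sqn_ge0// -sqrtr_sqr ler_wsqrtr//
    ell2_cauchy_schwarz.
by rewrite ler_norml => /andP[_]; set x := _ * _; rewrite mulr2n; lra.
Qed.

Lemma ell2_sqnZ a u : ell2_sqn (a *: u) = cmod a ^+ 2 * ell2_sqn u.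
Proof.
apply: (@complexI R); rewrite -ell2_inner_sqn linearZl_LR linearZr_LR/=
  ell2_inner_sqn.
rewrite mulrA -sqr_normc rmorphM/=; congr (_ * _).
by rewrite normCE rmorphXn.
Qed.

Lemma ell2_normrZ a u : ell2_norm (a *: u) = `|a| * ell2_norm u.
Proof.
rewrite /ell2_norm ell2_sqnZ sqrtrM ?sqr_ge0// sqrtr_sqr ger0_norm ?cmod_ge0//.
by rewrite rmorphM normCE.
Qed.

Lemma ell2_sqn_eq0 u : ell2_sqn u = 0 -> u = 0.
Proof.
move=> u0; apply/eqP; apply: contraT => /ell2_inner_gt0.
by rewrite ell2_inner_sqn u0 ltxx.
Qed.

Lemma ell2_normr0_eq0 u : ell2_norm u = 0 -> u = 0.
Proof.
move=> /complexI /eqP; rewrite sqrtr_eq0 => u0; apply: ell2_sqn_eq0.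
by apply/eqP; rewrite eq_le u0 ell2_sqn_ge0.
Qed.

HB.instance Definition _ := Lmodule_isNormed.Build R[i] ell2
  ell2_ler_normD ell2_normrZ ell2_normr0_eq0.

Lemma ell2_normE u : `|u| = (Num.sqrt (ell2_sqn u))%:C.
Proof. by []. Qed.

Lemma cmod_lt_ell2_norm u n e : `|u| < e%:C -> cmod (u n) < e.
Proof.
rewrite ell2_normE ltcR; apply: le_lt_trans.
by rewrite -[leLHS]ger0_norm ?cmod_ge0// -sqrtr_sqr ler_wsqrtr//
  cmod_le_ell2_sqn.
Qed.

(** The coordinates are Cauchy and converge to a sequence [l]. The Cauchy estimate on each finite
    sum passes to the limit in [u], uniformly in the length [n]. With [e = 1] this puts [l - v],
    hence [l], in l^2; with small [e] it gives convergence in norm. *)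
Lemma ell2_complete (F : set_system ell2) : ProperFilter F -> cauchy F -> cvg F.
Proof.
move=> FF /cauchy_ballP Fc.
have coord (h : R[i] -> R) : (forall z, `|h z| <= cmod z) ->
    {morph h : x y / x - y} -> forall n, cvg ((fun u : ell2 => h (u n)) @ F).
  move=> hle hB n; apply: cauchy_cvg; apply/cauchy_ballP => e e0.
  have e0C : 0 < e%:C :> R[i] by rewrite ltcR.
  have [[P Q] /= [FP FQ] PQ] := Fc e%:C e0C.
  exists ([set h (u n) | u in P], [set h (u n) | u in Q]) => /=.
    by split; [apply: filterS FP|apply: filterS FQ] => u /= Pu; exists u.
  move=> [_ _] /= [[u Pu <-] [v Qv <-]]; have := PQ (u, v) (conj Pu Qv) => /=.
  rewrite -ball_normE/= => /cmod_lt_ell2_norm - /(_ n).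
  by rewrite /ball/= -hB; apply: le_lt_trans; exact: hle.
have /choice[lr lrP] n :=
  proj1 (cvg_ex _) (coord _ (@abs_Re_le_cmod R) (raddfB _) n).
have /choice[li liP] n :=
  proj1 (cvg_ex _) (coord _ (@abs_Im_le_cmod R) (raddfB _) n).
pose l n := lr n +i* li n.
have lF (e : R) : 0 < e -> exists Q, F Q /\ forall v, Q v ->
    forall n, \sum_(k < n) cmod ((l - ell2_seq v) k) ^+ 2 <= e ^+ 2.
  move=> e0; have e0C : 0 < e%:C :> R[i] by rewrite ltcR.
  have [[P Q] /= [FP FQ] PQ] := Fc e%:C e0C.
  exists Q; split=> // v Qv n.
  pose S (u : ell2) :=
    \sum_(k < n) ((Re (u k) - Re (v k)) ^+ 2 + (Im (u k) - Im (v k)) ^+ 2).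
  have SF : S @ F -->
      \sum_(k < n) ((lr k - Re (v k)) ^+ 2 + (li k - Im (v k)) ^+ 2).
    apply: (cvg_big (op := +%R)) => [|k _]; first exact: add_continuous.
    rewrite !expr2; apply: cvgD.
      by apply: cvgM; (apply: cvgB; [exact: lrP|exact: cvg_cst]).
    by apply: cvgM; (apply: cvgB; [exact: liP|exact: cvg_cst]).
  have -> : \sum_(k < n) cmod ((l - ell2_seq v) k) ^+ 2 =
      \sum_(k < n) ((lr k - Re (v k)) ^+ 2 + (li k - Im (v k)) ^+ 2).
    by apply: eq_bigr => k _; rewrite sqr_cmod !fctE /l; case: (v k).
  apply: (cvgr_to_le SF); apply: filterS FP => u Pu.
  have := PQ (u, v) (conj Pu Qv) => /=; rewrite -ball_normE/= ell2_normE ltcR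
    => uv.
  have -> : S u = \sum_(k < n) cmod ((u - v) k) ^+ 2.
    by apply: eq_bigr => k _; rewrite sqr_cmod ell2D ell2N;
      case: (u k) (v k) => ? ? [].
  apply: (le_trans (ell2_sum_le_sqn _ _)).
  by rewrite -[leLHS]sqr_sqrtr ?ell2_sqn_ge0// lerXn2r// ?nnegrE ?sqrtr_ge0//
    ltW.
have lP : l \in ell2_pred.
  have [Q [FQ QP]] := lF 1 ltr01; have [v Qv] := filter_ex FQ.
  rewrite -[l](subrK (ell2_seq v)); apply: rpredD; last exact: ell2_seqP.
  by apply/ell2_predP; exists (1 ^+ 2); exact: QP.
apply/cvg_ex; exists (Ell2 lP); apply: cvg_hnorm => e e0.
have e20 : 0 < e / 2 by lra.
have [Q [FQ QP]] := lF (e / 2) e20; apply: filterS FQ => u Qu.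
rewrite /hnorm ell2_normE/=; apply: (@le_lt_trans _ _ (e / 2)); last by lra.
rewrite -[leRHS]ger0_norm ?(ltW e20)// -sqrtr_sqr ler_wsqrtr//.
by apply: ell2_sqn_le => n; exact: QP.
Qed.

HB.instance Definition _ := Uniform_isComplete.Build ell2 ell2_complete.

Lemma ell2_inner_norm u : ell2_inner u u = `|u| ^+ 2.
Proof. by rewrite ell2_inner_sqn ell2_normE -rmorphXn/= sqr_sqrtr//
  ell2_sqn_ge0. Qed.

Definition ell2_hilbert : hilbertSpace R := HilbertSpace ell2_inner_norm.

End ell2_module.

Arguments ell2_pred R : clear implicits.

(** * A diagonal operator in l^2 *)

Section diagonal_operator.
Context (R : realType).
Implicit Types (u v w : ell2 R).

Lemma finsupp_ell2_pred (x : nat -> R[i]) N :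
  (forall n, (N <= n)%N -> x n = 0) -> x \in ell2_pred R.
Proof.
move=> x0; apply/ell2_predP; exists (\sum_(k < N) cmod (x k) ^+ 2) => n.
have [nN|/ltnW Nn] := leqP n N.
  rewrite -(big_mkord predT (fun k => cmod (x k) ^+ 2))
    -(big_mkord predT (fun k => cmod (x k) ^+ 2)).
  rewrite [leRHS](big_cat_nat (leq0n n) nN)//= lerDl sumr_ge0// => k _;
    exact: sqr_ge0.
rewrite -(big_mkord predT (fun k => cmod (x k) ^+ 2))
  -(big_mkord predT (fun k => cmod (x k) ^+ 2)).
rewrite (big_cat_nat (leq0n N) Nn)//= gerDl big_nat_cond big1// =>
  k /andP[/andP[Nk _] _].
by rewrite x0// cmod0 expr0n.
Qed.

Lemma single_ell2_pred j : (fun n => (n == j)%:R) \in ell2_pred R.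
Proof.
by apply: (@finsupp_ell2_pred _ j.+1) => n jn; rewrite gtn_eqF.
Qed.

Definition ell2_basis j : ell2 R := Ell2 (single_ell2_pred j).

Lemma inner_ell2_basis u j : ell2_inner u (ell2_basis j) = u j.
Proof.
apply: ell2_inner_eq; have : u j = u j * (ell2_basis j j)^*.
  by rewrite /= eqxx rmorph1 mulr1.
move=> ->; apply: (@has_csum_single R (fun n => u n * (ell2_basis j n)^*)%C) =>
  n nj.
by rewrite /= (negbTE nj) rmorph0 mulr0.
Qed.

Lemma ell2_basis_inner u j : ell2_inner (ell2_basis j) u = (u j)^*.
Proof. by rewrite ell2_innerJ inner_ell2_basis. Qed.

(** The shift by one keeps the first eigenvalue strictly negative. *)
Definition diag_eigval (n : nat) : R := - n.+1%:R.

Definition diag_seq (x : nat -> R[i]) : nat -> R[i] :=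
  fun n => (diag_eigval n)%:C * x n.

(** The maximal domain, which makes the operator self-adjoint and not merely symmetric. *)
Definition diag_dom : set (ell2_hilbert R) :=
  [set u : ell2 R | diag_seq u \in ell2_pred R].

(* [0] outside [diag_dom]. *)
Definition diag_fun (u : ell2_hilbert R) : ell2_hilbert R :=
  insubd (0 : ell2 R) (diag_seq (u : ell2 R)).

Lemma diag_funE (u : ell2 R) n : diag_dom u ->
  (diag_fun u : ell2 R) n = (diag_eigval n)%:C * u n.
Proof. by move=> du; rewrite /diag_fun -[X in X n]/(val _) insubdK. Qed.

Lemma diag_dom0 : diag_dom 0.
Proof. by apply: (@finsupp_ell2_pred _ 0) => n _; rewrite /diag_seq mulr0. Qed.

Lemma diag_domP (a : R[i]) (u v : ell2_hilbert R) :
  diag_dom u -> diag_dom v -> diag_dom (a *: u + v).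
Proof.
move=> du dv; rewrite /diag_dom/=.
have -> : diag_seq (a *: (u : ell2 R) + v : ell2 R) =
    a *: diag_seq (u : ell2 R) + diag_seq (v : ell2 R).
  by apply/funext => n; rewrite /diag_seq ell2D ell2Z !fctE/= mulrDr mulrCA.
by apply: rpredD; [exact: rpredZ|].
Qed.

Lemma diag_funP (a : R[i]) (u v : ell2_hilbert R) :
  diag_dom u -> diag_dom v ->
  diag_fun (a *: u + v) = a *: diag_fun u + diag_fun v.
Proof.
move=> du dv; apply: (@ell2P R) => n; rewrite diag_funE; last exact: diag_domP.
by rewrite [RHS]ell2D ell2Z !diag_funE// ell2D ell2Z mulrDr mulrCA.
Qed.

Definition diag_op : operator (ell2_hilbert R) :=
  Operator diag_dom0 diag_domP diag_funP.

Lemma diag_dom_basis j : diag_dom (ell2_basis j).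
Proof.
apply: (@finsupp_ell2_pred _ j.+1) => n jn.
by rewrite /diag_seq/= gtn_eqF// mulr0.
Qed.

Lemma diag_eigfunP j : diag_op (ell2_basis j) =
  (diag_eigval j)%:C *: ell2_basis j :> ell2_hilbert R.
Proof.
apply: (@ell2P R) => n; rewrite [LHS]diag_funE; last exact: diag_dom_basis.
rewrite [RHS]ell2Z /=; have [->//|_] := eqVneq n j; by rewrite !mulr0.
Qed.

(** Truncations lie in the domain. A truncation [t] of [u] is orthogonal to [u - t], so by
    Pythagoras the squared error is at most the tail of the series for [ell2_sqn u]. *)
Lemma diag_dom_dense : dense diag_dom.
Proof.
move=> O [u0 Ou0] openO; pose u : ell2 R := u0.
have [e /= e0 eO] := proj1 (nbhs_normP u0 O) (open_nbhs_nbhs (conj openO Ou0)).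
have eR : e = (Re e)%:C by rewrite RRe_real// gtr0_real.
have e20 : 0 < Re e ^+ 2 by rewrite exprn_gt0// -ltcR -eR.
have := @ell2_sqn_cvg R u.
move=> /cvgrPdist_lt /(_ _ e20) [N _ /(_ N (leqnn N))] /=.
rewrite /series/= big_mkord ger0_norm; last by rewrite subr_ge0 ell2_sum_le_sqn.
move=> uN; pose x n := if (n < N)%N then u n else 0.
have xP : x \in ell2_pred R.
  by apply: (@finsupp_ell2_pred _ N) => n Nn; rewrite /x ltnNge Nn.
pose t : ell2 R := Ell2 xP.
have ut0 : ell2_inner (u - t) t = 0.
  apply: ell2_inner_eq.
  have E n : (u - t) n * (t n)^* = 0.
    rewrite ell2D ell2N /= /x; case: ifP => _; first by rewrite subrr mul0r.
    by rewrite rmorph0 mulr0.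
  by rewrite -(E 0%N); apply: (@has_csum_single R (fun n =>
    (u - t) n * (t n)^*)).
have ut : ell2_sqn u = ell2_sqn (u - t) + ell2_sqn t.
  rewrite -{1}(subrK t u); have := ell2_sqn_comb 1 1 (u - t) t.
  by rewrite !scale1r ut0/= !expr1n !mul1r mulr0 addr0.
have tN : \sum_(k < N) cmod (u k) ^+ 2 <= ell2_sqn t.
  apply: le_trans (ell2_sum_le_sqn t N); apply: ler_sum => k _.
  by rewrite /= /x ltn_ord.
exists t; split.
  apply: eO; rewrite /ball_/= eR ell2_normE ltcR.
  rewrite -[ltRHS]ger0_norm; last by rewrite -lecR -eR ltW.
  by rewrite -sqrtr_sqr ltr_sqrt//; move: uN ut tN; lra.
apply: (@finsupp_ell2_pred _ N) => n Nn.
by rewrite /diag_seq /= /x ltnNge Nn mulr0.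
Qed.

(** Testing the adjoint relation on basis vectors gives [diag_seq v = w] coordinatewise; as [w] is
    in l^2, [v] is in the maximal domain. The converse holds term by term because the eigenvalues
    are real. *)
Lemma diag_self_adjoint : self_adjoint diag_op.
Proof.
split; first exact: diag_dom_dense.
move=> v w; split.
  move=> adj; have E : diag_seq (v : ell2 R) = (w : ell2 R).
    apply/funext => n.
    have : ell2_inner ((diag_eigval n)%:C *: ell2_basis n) v =
        ell2_inner (ell2_basis n) w.
      by have := adj _ (diag_dom_basis n); rewrite diag_eigfunP.
    rewrite linearZl_LR/= !ell2_basis_inner => /(congr1 Num.conj).
    by rewrite rmorphM/= !conjCK => <-; congr (_ * _); rewrite [RHS]conjc_real.
  have dv : diag_dom v by rewrite /diag_dom/= E; exact: ell2_seqP.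
  split=> //; apply: (@ell2P R) => n.
  by rewrite [LHS]diag_funE// -E.
move=> [dv <-] u du; congr csum; apply/funext => n.
rewrite (diag_funE n du) (diag_funE n dv) rmorphM/= mulrCA mulrA.
by congr (_ * _ * _); exact/esym/conjc_real.
Qed.

Lemma diag_neg_positive : neg_positive diag_op.
Proof.
move=> u du; apply: has_csum_ge0 (ell2_inner_csum (- diag_fun u : ell2 R) u) =>
  n.
rewrite ell2N (diag_funE n du) mulNr -mulrA -mulNr -rmorphN opprK.
by rewrite mulr_ge0 ?mul_conjC_ge0// ler0c.
Qed.

Lemma ell2_basis_complete :
  complete_orthonormal (ell2_basis : nat -> ell2_hilbert R).
Proof.
split=> [i j|u u0].
  by rewrite [LHS]inner_ell2_basis /= eq_sym.
by apply: (@ell2P R) => n; rewrite -[LHS]inner_ell2_basis; exact: u0.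
Qed.

Lemma diag_eigval_lt0 j : diag_eigval j < 0.
Proof. by rewrite oppr_lt0. Qed.

Lemma diag_eigval_cvg : diag_eigval j @[j --> \oo] --> -oo.
Proof.
apply/cvgrNyPle => B; exists (Num.truncn (- B)).+1 => // n /= Bn.
rewrite /diag_eigval lerNl; apply: (le_trans (ltW (truncnS_gt _))).
by rewrite ler_nat leqW.
Qed.

Definition diag_eigenOperator : eigenOperator (ell2_hilbert R) :=
  EigenOperator diag_self_adjoint diag_neg_positive ell2_basis_complete
    diag_dom_basis diag_eigfunP diag_eigval_lt0 diag_eigval_cvg.

End diagonal_operator.

Theorem theorem27 (R : realType) (tau eps : R) (tau_gt0 : 0 < tau)
    (eps_gt0 : 0 < eps) :
  (forall (m : nat) (alpha : R), (2 <= m)%N -> alpha < 1 ->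
     exists (H : hilbertSpace R) (A : eigenOperator H),
       ill_posed A m tau eps alpha) /\
  (forall alpha : R, alpha < 1 ->
     forall (H : hilbertSpace R) (A : eigenOperator H),
       ill_posed A 2 tau eps alpha).
Proof.
split=> [[//|m] alpha _ alpha1|alpha alpha1 H A].
  exists (ell2_hilbert R), (diag_eigenOperator R).
  exact: ill_posed_eigenOperator.
exact: ill_posed_eigenOperator.
Qed.
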